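(* Suppose $\gamma^0=\emptyset$, i.e. $\mathbf y=\epsilon\sim N(0,\sigma_0^2I_n)$, and that Assumptions A1, A5, A6, A7 and A8 hold, with $\delta\ge0$ the constant of Assumption A8. (i) If $p^{\alpha_0}=o(n^{1-\delta}\underline{\phi}_n)$ for some $\alpha_0>2$, then $\sup_{c_1,\ldots,c_p\in[\underline{\phi}_n,\bar{\phi}_n]}\max_{\gamma\neq\gamma^0}p(\gamma|Z)/p(\gamma^0|Z)\to0$ in probability. (ii) If $p^{\alpha_0+2}=o(n^{1-\delta}\underline{\phi}_n)$ for some $\alpha_0>2$, then $\sup_{c_1,\ldots,c_p\in[\underline{\phi}_n,\bar{\phi}_n]}\sum_{\gamma\neq\gamma^0}p(\gamma|Z)\to0$ in probability, and consequently $\inf_{c_1,\ldots,c_p\in[\underline{\phi}_n,\bar{\phi}_n]}p(\gamma^0|Z)\to1$ in probability.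
   Context: Setting. For each $n$, let $p=p_n$, let $X=(X_1,\dots,X_p)$ be an $n\times p$ design matrix, either deterministic or random and independent of $\epsilon$, such that all matrices $X_\gamma^TX_\gamma$ below are invertible (a.s.), and let the data be $\mathbf y=X\beta^0+\epsilon$ with $\epsilon\sim N(0,\sigma_0^2I_n)$ and $\beta^0\in\mathbb R^p$ ($X,\beta^0,p$ may depend on $n$); $Z=(\mathbf y,X)$. A model is a state vector $\gamma\in\{0,1\}^p$; $|\gamma|$ is its number of ones; $X_\gamma$ (resp. $\beta_\gamma$) is the submatrix of columns of $X$ (resp. subvector of $\beta$) indexed by $\{j:\gamma_j=1\}$. The true model is $\gamma^0$ with $\gamma^0_j=I(\beta^0_j\neq0)$; $s_n=|\gamma^0|$; $k_n=\|\beta^0_{\gamma^0}\|_2^2$; $\emptyset$ is the zero vector (null model). For state vectors, $\gamma\setminus\gamma'$ has $j$-th entry $I(\gamma_j=1,\gamma'_j=0)$, and $\gamma\subset\gamma'$ means $\gamma\setminus\gamma'=0$. $P_\gamma=X_\gamma(X_\gamma^TX_\gamma)^{-1}X_\gamma^T$, $P_\emptyset=0$. $S_1=\{\gamma:\gamma^0\subset\gamma,\gamma\neq\gamma^0\}$. $\lambda_-(A)$ is the smallest eigenvalue. Bayesian model: $\mathbf y|\beta,\sigma^2\sim N(X\beta,\sigma^2I_n)$; independently $\beta_j|\gamma_j,\sigma^2\sim(1-\gamma_j)\delta_0+\gamma_jN(0,c_j\sigma^2)$ ($\delta_0$ point mass at 0, $c_j>0$ hyperparameters); $1/\sigma^2\sim\chi^2_\nu$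 with $\nu>0$ fixed; $\gamma\sim p(\gamma)$ a prior on $\{0,1\}^p$. Let $\Sigma=\mathrm{diag}(c_1,\dots,c_p)$, $\Sigma_\gamma$ its diagonal submatrix indexed by $\gamma$, $U_\gamma=\Sigma_\gamma^{-1}+X_\gamma^TX_\gamma$, $W_\gamma=\Sigma_\gamma^{1/2}U_\gamma\Sigma_\gamma^{1/2}$ (conventions $X_\emptyset=0$, $\Sigma_\emptyset=U_\emptyset=W_\emptyset=1$). The posterior model probability is $p(\gamma|Z)\propto\det(W_\gamma)^{-1/2}p(\gamma)\{1+\mathbf y^T(I_n-X_\gamma U_\gamma^{-1}X_\gamma^T)\mathbf y\}^{-(n+\nu)/2}$, normalized over all $\gamma\in\{0,1\}^p$. All limits are as $n\to\infty$. Assumptions. A1: there is $C_0>0$ with $\max_{\gamma}p(\gamma)/p(\gamma^0)\le C_0$ for all $n$. A5: $p\to\infty$, $s_n\le p\le n$, and $p\log p=o(n)$. A6: $\bar\phi_n=O(n^{\delta_0})$ for some $\delta_0>0$, and $\max_jc_j\le\bar\phi_n$. A7: $\underline\phi_n$ is a positive sequence with $k_n=O(\underline\phi_n)$ and $\min_jc_j\ge\underline\phi_n$. A8: there are $C_3>0$ and $\delta\ge0$ with $n^{1-\delta}\underline\phi_n\to\infty$ and, for every $n$, with probability one, $\inf_{\gamma\in S_1}\lambda_-\big(\frac1nX_{\gamma\setminus\gamma^0}^T(I_n-P_{\gamma^0})X_{\gamma\setminus\gamma^0}\big)\ge C_3n^{-\delta}$. *)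

(* Defs.v *)
From HB Require Import structures.
From mathcomp Require Import all_boot all_order all_algebra.
From mathcomp Require Import all_classical all_reals all_analysis.
From mathcomp Require Import normal_distribution.

Set Implicit Arguments.
Unset Strict Implicit.
Unset Printing Implicit Defensive.

Import Order.TTheory GRing.Theory Num.Theory.
Import numFieldTopology.Exports.
Local Open Scope classical_set_scope.
Local Open Scope ring_scope.

Section Defs.
Context {R : realType}.

Definition Xsub {n p : nat} (X : 'M[R]_(n, p)) (g : {set 'I_p}) : 'M[R]_(n, #|g|) :=
  colsub (fun k : 'I_#|g| => enum_val k) X.

Definition Sigsub {p : nat} (c : 'I_p -> R) (g : {set 'I_p}) : 'M[R]_#|g| :=
  diag_mx (\row_(k < #|g|) c (enum_val k)).
Definition Sigsub_sqrt {p : nat} (c : 'I_p -> R) (g : {set 'I_p}) : 'M[R]_#|g| :=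
  diag_mx (\row_(k < #|g|) Num.sqrt (c (enum_val k))).

Definition Umat {n p : nat} (X : 'M[R]_(n, p)) (c : 'I_p -> R) (g : {set 'I_p}) :
  'M[R]_#|g| := invmx (Sigsub c g) + (Xsub X g)^T *m Xsub X g.

Definition Wmat {n p : nat} (X : 'M[R]_(n, p)) (c : 'I_p -> R) (g : {set 'I_p}) :
  'M[R]_#|g| := Sigsub_sqrt c g *m Umat X c g *m Sigsub_sqrt c g.

(* Unnormalized posterior weight
   det(W_g)^{-1/2} p(g) {1 + y^T (I_n - X_g U_g^{-1} X_g^T) y}^{-(n+nu)/2}.
   For g = set0 the 0x0 matrices give the conventions det W = 1, X_g = 0. *)
Definition post_weight {n p : nat} (nu : R) (prior : {set 'I_p} -> R)
  (X : 'M[R]_(n, p)) (y : 'cV[R]_n) (c : 'I_p -> R) (g : {set 'I_p}) : R :=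
  (\det (Wmat X c g)) `^ (- (2^-1)) * prior g *
  (1 + (y^T *m (1%:M - Xsub X g *m invmx (Umat X c g) *m (Xsub X g)^T) *m y) 0 0)
    `^ (- ((n%:R + nu) / 2)).

Definition posterior {n p : nat} (nu : R) (prior : {set 'I_p} -> R)
  (X : 'M[R]_(n, p)) (y : 'cV[R]_n) (c : 'I_p -> R) (g : {set 'I_p}) : R :=
  post_weight nu prior X y c g /
  \sum_(g' : {set 'I_p}) post_weight nu prior X y c g'.

Definition lambda_min {m : nat} (A : 'M[R]_m) : R := inf [set a : R | eigenvalue A a].

End Defs.

(* Convergence to 0 in (outer) probability of a sequence of events E n:
   for every eta > 0, eventually E n is contained in a measurable event of
   probability < eta. (Equals P(E n) -> 0 when the E n are measurable.) *)
Definition outer_prob_to0 {R : realType} {d : measure_display}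
  {T : measurableType d} (P : probability T R) (E : nat -> set T) : Prop :=
  forall eta : R, 0 < eta ->
    \forall n \near \oo, exists A : set T,
      [/\ measurable A, E n `<=` A & (P A < eta%:E)%E].

(* Main.v *)
(** For a submodel [g] of size [q], the determinant factor of the posterior
    weight is at most [(C3 N)^(-q/2)] with [N = n^(1-delta) phi_lo], and since
    [X_g U_g^-1 X_g^T <= P_g], the residual factor is at most
    [(1 - eps^T P_g eps / (1 + |eps|^2))^(-(n+nu)/2)].  The noise is controlled
    by Chernoff bounds: with high probability [|eps|^2 >= (1-xi) n sigma^2] and,
    for any [alpha > 2] and simultaneously for all [g],
    [eps^T P_g eps <= alpha sigma^2 q ln p], the union bound over models being
    [sum_g tau^|g| = (1+tau)^p - 1] with [p tau -> 0].  Taking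
    [2 < alpha < alpha0], the posterior ratio is then at most
    [C0 (p^alpha0 / (C3 N))^(q/2)], uniformly in [c], which gives (i), and (ii)
    after summation over [g].

    The exponential moments come from
    [E exp ((|eps|^2 - eps^T M eps) / (2 sigma^2)) = E (det M)^(-1/2)] for a
    positive definite random [M] that is a function of the design, used with
    [M = 1 - s P_g] and [M = (1 + 2t) 1]. *)
Require Import Defs.
From HB Require Import structures.
From mathcomp Require Import all_boot all_order all_algebra.
From mathcomp Require Import all_classical all_reals all_analysis.
From mathcomp Require Import measurable_realfun normal_distribution.
From mathcomp Require Import ring lra.
Import Order.TTheory GRing.Theory Num.Theory.
Import numFieldTopology.Exports.
Local Open Scope classical_set_scope.
Local Open Scope ring_scope.

(** * Quadratic forms, Schur complements and projections *)

Section QuadraticForms.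
Context {R : realType}.

Definition qf {n : nat} (M : 'M[R]_n) (v : 'cV[R]_n) : R := (v^T *m M *m v) 0 0.
Definition nsq {n : nat} (v : 'cV[R]_n) : R := (v^T *m v) 0 0.
(** With [lam = 0] this is positive semidefiniteness. Lower bounds on forms take the place of
    diagonalization below. *)
Definition coercive {n : nat} (lam : R) (M : 'M[R]_n) :=
  forall v, lam * nsq v <= qf M v.

Lemma nsqE n (v : 'cV[R]_n) : nsq v = \sum_i v i 0 ^+ 2.
Proof. by rewrite /nsq mxE; apply: eq_bigr => i _; rewrite mxE expr2. Qed.

Lemma nsq_ge0 n (v : 'cV[R]_n) : 0 <= nsq v.
Proof. by rewrite nsqE; apply: sumr_ge0 => i _; exact: sqr_ge0. Qed.

Lemma nsq_eq0 n (v : 'cV[R]_n) : (nsq v == 0) = (v == 0).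
Proof.
apply/eqP/eqP => [|->]; last by rewrite /nsq mulmx0 mxE.
rewrite nsqE => /eqP; rewrite psumr_eq0 => [/allP v0|i _]; last exact: sqr_ge0.
apply/matrixP => i j; rewrite mxE (ord1 j).
by have /implyP := v0 i (mem_index_enum _); rewrite sqrf_eq0 => /(_ isT)/eqP.
Qed.

Lemma qfDl n (M N : 'M[R]_n) v : qf (M + N) v = qf M v + qf N v.
Proof. by rewrite /qf mulmxDr mulmxDl mxE. Qed.

Lemma qfBl n (M N : 'M[R]_n) v : qf (M - N) v = qf M v - qf N v.
Proof. by rewrite /qf mulmxBr mulmxBl mxE [X in _ + X = _]mxE. Qed.

Lemma qfZl n a (M : 'M[R]_n) v : qf (a *: M) v = a * qf M v.
Proof. by rewrite /qf -scalemxAr -scalemxAl mxE. Qed.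

Lemma qf1 n (v : 'cV[R]_n) : qf 1%:M v = nsq v.
Proof. by rewrite /qf mulmx1. Qed.

Lemma qf_scalar n a (v : 'cV[R]_n) : qf a%:M v = a * nsq v.
Proof. by rewrite -scalemx1 qfZl qf1. Qed.

Lemma qf_congr m n (A : 'M[R]_(m, n)) (M : 'M[R]_m) v :
  qf (A^T *m M *m A) v = qf M (A *m v).
Proof. by rewrite /qf trmx_mul !mulmxA. Qed.

Lemma qf_gram m n (A : 'M[R]_(m, n)) v : qf (A^T *m A) v = nsq (A *m v).
Proof. by rewrite -[A^T]mulmx1 qf_congr qf1. Qed.

Lemma qf_diag n (d : 'rV[R]_n) v : qf (diag_mx d) v = \sum_i d 0 i * v i 0 ^+ 2.
Proof.
rewrite /qf mul_mx_diag mxE; apply: eq_bigr => i _.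
by rewrite !mxE expr2; ring.
Qed.

Lemma tr_entry (N : 'M[R]_1) : N^T 0 0 = N 0 0.
Proof. by rewrite mxE. Qed.

Lemma qf_sub n (M : 'M[R]_n) (a b : 'cV[R]_n) : M^T = M ->
  qf M (a - b) = qf M a - (a^T *m M *m b) 0 0 *+ 2 + qf M b.
Proof.
move=> MT; have ba : (b^T *m M *m a) 0 0 = (a^T *m M *m b) 0 0.
  by rewrite -[LHS]tr_entry !trmx_mul trmxK MT mulmxA.
rewrite /qf [(a - b)^T]linearB /= !(mulmxBl, mulmxBr).
have subE (N1 N2 : 'M[R]_1) : (N1 - N2) 0 0 = N1 0 0 - N2 0 0 by rewrite !mxE.
rewrite !subE ba; ring.
Qed.

Lemma coercive_unitmx n lam (M : 'M[R]_n) : 0 < lam -> coercive lam M ->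
  M \in unitmx.
Proof.
move=> lam0 cM; rewrite -unitmx_tr unitmxE unitfE; apply/negP => /det0P[v v0 vM].
have := cM v^T; rewrite /qf trmxK -tr_entry trmx_mul trmxK trmx_mul mulmxA vM mul0mx.
rewrite mxE pmulr_rle0// => n0; move: v0; rewrite -(inj_eq trmx_inj) trmx0.
by rewrite -nsq_eq0 eq_le n0 nsq_ge0.
Qed.

(** The complement of the single entry [M 0 0], so that inductions on the dimension peel off one
    coordinate at a time. *)
Definition schur {n : nat} (M : 'M[R]_(1 + n)) : 'M[R]_n :=
  drsubmx M - (M 0 0)^-1 *: (dlsubmx M *m ursubmx M).

Lemma ulsubmx_scalar n (M : 'M[R]_(1 + n)) : ulsubmx M = (M 0 0)%:M.
Proof.
apply/matrixP => i j; rewrite !mxE !ord1 eqxx mulr1n.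
by congr (M _ _); apply: val_inj.
Qed.

Lemma det_schur n (M : 'M[R]_(1 + n)) : M 0 0 != 0 ->
  \det M = M 0 0 * \det (schur M).
Proof.
(* Right multiplication by the unipotent [N] clears the first row beyond [M 0 0] and leaves a block
   lower triangular matrix. *)
move=> m0; set N := block_mx 1%:M (- (M 0 0)^-1 *: ursubmx M) 0 1%:M.
have dN : \det N = 1 by rewrite det_ublock !det1 mulr1.
rewrite -[LHS]mulr1 -dN -det_mulmx -{1}(submxK M) mulmx_block !mulmx1 !mulmx0 !addr0.
rewrite ulsubmx_scalar -!scalemxAr mul_scalar_mx scalerA mulNr mulVf// scaleN1r addNr.
rewrite det_lblock det_scalar1; congr (_ * \det _).
by rewrite /schur scaleNr addrC.
Qed.

Lemma sym_dlsubmx n (M : 'M[R]_(1 + n)) : M^T = M -> dlsubmx M = (ursubmx M)^T.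
Proof. by move=> MT; rewrite trmx_ursub MT. Qed.

Lemma schur_sym n (M : 'M[R]_(1 + n)) : M^T = M -> (schur M)^T = schur M.
Proof.
move=> MT; rewrite /schur linearB linearZ /= trmx_drsub MT trmx_mul.
by rewrite sym_dlsubmx// trmxK.
Qed.

Lemma qf_block n (M : 'M[R]_(1 + n)) x v : M^T = M ->
  qf M (col_mx x%:M v) =
    M 0 0 * x ^+ 2 + (x * (ursubmx M *m v) 0 0) *+ 2 + qf (drsubmx M) v.
Proof.
move=> MT; rewrite /qf -{1}(submxK M) tr_col_mx mul_row_block mul_row_col.
rewrite ulsubmx_scalar sym_dlsubmx// tr_scalar_mx !mulmxDl -trmx_mul -mulmxA.
have addE (N1 N2 : 'M[R]_1) : (N1 + N2) 0 0 = N1 0 0 + N2 0 0 by rewrite mxE.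
have mulE (N1 N2 : 'M[R]_1) : (N1 *m N2) 0 0 = N1 0 0 * N2 0 0.
  by rewrite mxE big_ord1.
have scalE a : (a%:M : 'M[R]_1) 0 0 = a by rewrite mxE eqxx.
by rewrite -[X in _ + (X + _)]mulmxA !(addE, mulE, scalE) tr_entry; ring.
Qed.

(** Completes the square in the first coordinate. *)
Lemma qf_schur n (M : 'M[R]_(1 + n)) x v : M^T = M -> M 0 0 != 0 ->
  qf M (col_mx x%:M v) =
    M 0 0 * (x + (M 0 0)^-1 * (ursubmx M *m v) 0 0) ^+ 2 + qf (schur M) v.
Proof.
move=> MT m0; rewrite qf_block// /schur qfBl qfZl sym_dlsubmx// qf_gram.
rewrite nsqE big_ord1.
set b := (ursubmx M *m v) 0 0; by field.
Qed.

Lemma nsq_col n x (v : 'cV[R]_n) : nsq (col_mx x%:M v : 'cV[R]_(1 + n)) = x ^+ 2 + nsq v.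
Proof.
by rewrite /nsq tr_col_mx mul_row_col tr_scalar_mx -scalar_mxM mxE mxE eqxx expr2.
Qed.

Lemma coercive_diag n lam (M : 'M[R]_(1 + n)) : M^T = M -> coercive lam M ->
  lam <= M 0 0.
Proof.
move=> MT /(_ (col_mx 1%:M 0)); rewrite nsq_col qf_block// !mulmx0 /qf mulmx0.
by rewrite /nsq mulmx0 !mxE !expr1n mulr0 mul0rn !addr0 !mulr1.
Qed.

(** The form is evaluated at the first coordinate that minimises it, where the square in [qf_schur]
    vanishes. *)
Lemma coercive_schur n lam (M : 'M[R]_(1 + n)) : 0 < lam -> M^T = M ->
  coercive lam M -> coercive lam (schur M).
Proof.
move=> lam0 MT cM v; have m0 := lt_le_trans lam0 (coercive_diag _ _ _ MT cM).
have := cM (col_mx (- ((M 0 0)^-1 * (ursubmx M *m v) 0 0))%:M v).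
rewrite qf_schur ?gt_eqF// addNr expr0n mulr0 add0r; apply: le_trans.
by rewrite nsq_col mulrDr lerDr mulr_ge0 ?sqr_ge0 ?ltW.
Qed.

(** By Gaussian elimination: every pivot is at least [lam], since coercivity passes to the Schur
    complement. *)
Lemma coercive_det n lam (M : 'M[R]_n) : 0 < lam -> M^T = M ->
  coercive lam M -> lam ^+ n <= \det M.
Proof.
move=> lam0; elim: n M => [|n IH] M MT cM; first by rewrite det_mx00 expr0.
have lm := coercive_diag _ _ _ MT cM.
rewrite det_schur ?gt_eqF ?(lt_le_trans lam0)// exprS.
apply: ler_pM => //; [exact: ltW|exact/exprn_ge0/ltW|].
by apply: IH; [exact: schur_sym|exact: coercive_schur].
Qed.

Lemma entry_le_nsq n (v : 'cV[R]_n) i j : `|v i 0| * `|v j 0| <= nsq v.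
Proof.
have sq k : `|v k 0| ^+ 2 <= nsq v.
  rewrite real_normK ?num_real// nsqE (bigD1 k)//= lerDl.
  by apply: sumr_ge0 => l _; exact: sqr_ge0.
have [ij|/ltW ij] := leP `|v i 0| `|v j 0|.
  by apply: le_trans (sq j); rewrite expr2 ler_wpM2r.
by apply: le_trans (sq i); rewrite expr2 ler_wpM2l.
Qed.

(** A crude bound: only the finiteness of the constant matters, for the choice of [K] in
    [psd_unitmx_coercive]. *)
Lemma qf_le n (M : 'M[R]_n) v : qf M v <= (\sum_i \sum_j `|M i j|) * nsq v.
Proof.
rewrite /qf -mulmxA mxE mulr_suml; apply: ler_sum => i _.
rewrite !mxE mulr_sumr mulr_suml; apply: ler_sum => j _.
apply: (le_trans (ler_norm _)); rewrite mulrCA !normrM ler_wpM2l//.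
exact: entry_le_nsq.
Qed.

Lemma qf_invmx n (M : 'M[R]_n) v : M^T = M -> M \in unitmx ->
  qf (invmx M) v = qf M (invmx M *m v).
Proof. by move=> MT Mu; rewrite -qf_congr trmx_inv MT mulVmx// mul1mx. Qed.

(* Cauchy-Schwarz for the form [M], in the guise [0 <= qf M (t v - M^-1 v)]. *)
Lemma psd_unitmx_coercive n (M : 'M[R]_n) : M^T = M -> coercive 0 M ->
  M \in unitmx -> exists2 lam, 0 < lam & coercive lam M.
Proof.
move=> MT M0 Mu; set K := 1 + \sum_i \sum_j `|invmx M i j|.
have K0 : 0 < K.
  by rewrite ltr_pwDl// sumr_ge0// => i _; rewrite sumr_ge0.
exists K^-1 => [|v]; first by rewrite invr_gt0.
have := M0 (K *: v - invmx M *m v); rewrite mul0r qf_sub//.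
have -> : qf M (K *: v) = K ^+ 2 * qf M v.
  by rewrite /qf [(K *: v)^T]linearZ /= -!scalemxAl -scalemxAr scalerA mxE expr2.
have -> : ((K *: v)^T *m M *m (invmx M *m v)) 0 0 = K * nsq v.
  by rewrite mulmxA mulmxK// [(K *: v)^T]linearZ /= -scalemxAl mxE.
rewrite -qf_invmx//.
move=> h; have Iv := qf_le _ (invmx M) v; have v0 := nsq_ge0 _ v.
have Iv' : qf (invmx M) v <= K * nsq v by apply: (le_trans Iv); rewrite ler_wpM2r// lerDr.
rewrite ler_pdivrMl// -(ler_pM2l K0) mulrA -expr2; lra.
Qed.

(* [sup {t | A - t >= 0}] is attained, and [A - t] cannot be invertible there;
   hence it is an eigenvalue, so that [lambda_min A] bounds the form below. *)
Lemma coercive_lambda_min n (A : 'M[R]_n) : A^T = A -> coercive 0 A ->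
  coercive (lambda_min A) A.
Proof.
case: n A => [|n] A AT A0.
  by move=> v; rewrite nsqE big_ord0 mulr0 /qf mxE big_ord0.
pose S := [set t : R | coercive t A].
have S0 : S !=set0 by exists 0.
have ubS : has_ubound S.
  by exists (A 0 0) => t /= tA; exact: (coercive_diag n).
have supS : has_sup S by split.
pose mu := sup S.
have muA : coercive mu A.
  move=> v; have [v0|v0] := eqVneq (nsq v) 0.
    by move: v0 => /eqP; rewrite nsq_eq0 => /eqP ->; rewrite /qf /nsq !mulmx0 mxE mulr0.
  have v1 : 0 < nsq v by rewrite lt_neqAle eq_sym v0 nsq_ge0.
  rewrite -ler_pdivlMr//; apply: sup_le_ub => // t tA.
  by rewrite ler_pdivlMr.
have mueig : eigenvalue A mu.
  case: (boolP (eigenvalue A mu)) => // nemu; exfalso.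
  have Bu : A - mu%:M \in unitmx.
    rewrite unitmxE unitfE; apply/det0P => -[v v0]; rewrite mulmxBr mul_mx_scalar.
    move/eqP; rewrite subr_eq0 => /eqP vA.
    by case/negP: nemu; apply/eigenvalueP; exists v.
  have BT : (A - mu%:M)^T = A - mu%:M by rewrite linearB /= AT tr_scalar_mx.
  have [|lam lam0 cB] := psd_unitmx_coercive _ _ BT _ Bu.
    by move=> v; rewrite mul0r qfBl qf_scalar subr_ge0.
  have : S (mu + lam).
    by move=> v; rewrite mulrDl -lerBrDl; have := cB v; rewrite qfBl qf_scalar.
  by move/(ub_le_sup ubS); rewrite -/mu gerDl leNgt lam0.
move=> v; apply: le_trans (muA v); rewrite ler_wpM2r ?nsq_ge0//.
(* [inf] is a lower bound only on a set bounded below; 0 serves, as eigenvalues of a positive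
   semidefinite matrix are nonnegative. *)
apply: ge_inf => //; exists 0 => t /= /eigenvalueP[u uA u0].
have := A0 u^T; rewrite mul0r /qf trmxK uA -scalemxAl mxE.
rewrite (_ : (u *m u^T) 0 0 = nsq u^T); last by rewrite /nsq trmxK.
rewrite pmulr_lge0// lt_neqAle nsq_ge0 andbT eq_sym nsq_eq0.
by rewrite -(inj_eq trmx_inj) trmxK trmx0.
Qed.

(** The block matrix with rows [1, A] and [B, 1] is factored in two ways. *)
Lemma det_sylvester m n (A : 'M[R]_(m, n)) (B : 'M[R]_(n, m)) :
  \det (1%:M - A *m B) = \det (1%:M - B *m A).
Proof.
have E : block_mx 1%:M A 0 1%:M *m block_mx (1%:M - A *m B) 0 B 1%:M =
    block_mx 1%:M 0 B 1%:M *m block_mx 1%:M A 0 (1%:M - B *m A).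
  rewrite !mulmx_block !mul0mx !mulmx0 !mul1mx !mulmx1 !addr0 !add0r.
  by rewrite subrK addrC subrK.
move/(congr1 (fun M => \det M)) : E; rewrite !det_mulmx !det_ublock !det_lblock.
by rewrite !det1 !mul1r !mulr1.
Qed.

(* Orthogonal projection onto the column space of [X]. The determinant is
   inverted in the field, so that this is [0] when [X^T X] is singular. *)
Definition colproj {n q : nat} (X : 'M[R]_(n, q)) : 'M[R]_n :=
  (\det (X^T *m X))^-1 *: (X *m \adj (X^T *m X) *m X^T).

Lemma gram_sym n q (X : 'M[R]_(n, q)) : (X^T *m X)^T = X^T *m X.
Proof. by rewrite trmx_mul trmxK. Qed.

Lemma coercive0_gram n q (X : 'M[R]_(n, q)) : coercive 0 (X^T *m X).
Proof. by move=> v; rewrite mul0r qf_gram nsq_ge0. Qed.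

Lemma projE n q (X : 'M[R]_(n, q)) : X^T *m X \in unitmx ->
  colproj X = X *m invmx (X^T *m X) *m X^T.
Proof. by move=> Xu; rewrite /colproj /invmx Xu -scalemxAr -scalemxAl. Qed.

Lemma proj_sing n q (X : 'M[R]_(n, q)) : X^T *m X \notin unitmx -> colproj X = 0.
Proof.
by rewrite unitmxE unitfE negbK /colproj => /eqP ->; rewrite invr0 scale0r.
Qed.

Lemma proj_sym n q (X : 'M[R]_(n, q)) : (colproj X)^T = colproj X.
Proof.
by rewrite /colproj linearZ /= !trmx_mul trmxK -mulmxA trmx_adj gram_sym.
Qed.

Lemma qf_projE n q (X : 'M[R]_(n, q)) v : X^T *m X \in unitmx ->
  qf (colproj X) v = qf (invmx (X^T *m X)) (X^T *m v).
Proof. by move=> Xu; rewrite projE// -qf_congr trmxK. Qed.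

Lemma qf_proj_ge0 n q (X : 'M[R]_(n, q)) v : 0 <= qf (colproj X) v.
Proof.
have [Xu|/proj_sing ->] := boolP (X^T *m X \in unitmx); last first.
  by rewrite /qf mulmx0 mul0mx mxE.
by rewrite qf_projE// qf_invmx ?gram_sym// qf_gram nsq_ge0.
Qed.

(** The difference is the residual sum of squares at the least-squares coefficient [b]; in the
    singular case [colproj X] is 0. *)
Lemma qf_proj_le n q (X : 'M[R]_(n, q)) v : qf (colproj X) v <= nsq v.
Proof.
have [Xu|/proj_sing ->] := boolP (X^T *m X \in unitmx); last first.
  by rewrite /qf mulmx0 mul0mx mxE nsq_ge0.
rewrite -subr_ge0; set b := invmx (X^T *m X) *m (X^T *m v).
have := nsq_ge0 _ (v - X *m b); rewrite -qf1 qf_sub ?trmx1// mulmx1 !qf1 -qf_gram.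
rewrite -qf_congr trmx_inv gram_sym mulVmx// mul1mx -qf_projE//.
rewrite /b !mulmxA (_ : _ 0 0 = qf (colproj X) v); first by rewrite mulr2n; lra.
by rewrite /qf projE// !mulmxA.
Qed.

Lemma coercive_1Bproj n q s (X : 'M[R]_(n, q)) : 0 <= s ->
  coercive (1 - s) (1%:M - s *: colproj X).
Proof.
move=> s0 v; rewrite qfBl qfZl qf1 mulrBl mul1r lerB// ler_wpM2l//.
exact: qf_proj_le.
Qed.

(** Sylvester's identity turns the determinant into that of the scalar matrix [1 - s] of size [q].
    In the singular case it is 1, which is larger. *)
Lemma det_1Bproj n q s (X : 'M[R]_(n, q)) : 0 <= s <= 1 ->
  (1 - s) ^+ q <= \det (1%:M - s *: colproj X).
Proof.
move=> /andP[s0 s1]; have [Xu|/proj_sing ->] := boolP (X^T *m X \in unitmx).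
  rewrite projE// -mulmxA scalemxAl det_sylvester -scalemxAr -mulmxA mulVmx//.
  by rewrite scalemx1 -raddfB det_scalar.
rewrite scaler0 subr0 det1 exprn_ile1// ?subr_ge0// lerBlDr lerDl//.
Qed.

(* [0 <= (a - b)^T G (a - b)] for [a = (D + G)^-1 u] and [b = G^-1 u]. *)
Lemma qf_inv_le n (G D : 'M[R]_n) u : G^T = G -> D^T = D ->
  coercive 0 G -> coercive 0 D -> G \in unitmx -> D + G \in unitmx ->
  qf (invmx (D + G)) u <= qf (invmx G) u.
Proof.
move=> GT DT G0 D0 Gu DGu; set a := invmx (D + G) *m u; set b := invmx G *m u.
have DGT : (D + G)^T = D + G by rewrite linearD /= DT GT.
have aU : qf (D + G) a = qf (invmx (D + G)) u.
  by rewrite qf_invmx.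
have bG : qf G b = qf (invmx G) u.
  by rewrite qf_invmx.
have ab : (a^T *m G *m b) 0 0 = qf (invmx (D + G)) u.
  by rewrite /b mulmxA mulmxK// /a trmx_mul trmx_inv DGT.
have := G0 (a - b); rewrite mul0r qf_sub// ab bG -aU qfDl.
have := D0 a; rewrite mul0r; lra.
Qed.

End QuadraticForms.

(** * Integrals against a centred normal law *)

Section NormalIntegrals.
Context {R : realType}.
Local Open Scope ereal_scope.
Import HBNNSimple.
Notation mu := (@lebesgue_measure R).

(** The case of simple functions, from which [integral_normal_prob] follows by monotone convergence
    on both sides. *)
Let integral_normal_prob_nnsfun (s : R) (f : {nnsfun R >-> R}) :
  \int[normal_prob 0 s]_x (f x)%:E =
  \int[mu]_x ((f x)%:E * (normal_pdf 0 s x)%:E).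
Proof.
have mpdf : measurable_fun [set: R] (fun x : R => (normal_pdf 0 s x)%:E).
  by apply/measurable_EFinP; exact: measurable_normal_pdf.
have pdf0 x : 0 <= (normal_pdf 0 s x)%:E by rewrite lee_fin normal_pdf_ge0.
have mi r : measurable_fun [set: R] (fun x : R => (\1_(f @^-1` [set r]) x)%:E).
  by apply/measurable_EFinP; exact: measurable_indic.
have mt r : measurable_fun [set: R] (fun x : R => (r * \1_(f @^-1` [set r]) x)%:E).
  by apply/measurable_EFinP; exact: measurableT_comp.
under [LHS]eq_integral do rewrite fimfunE -fsumEFin//.
rewrite [LHS]ge0_integral_fsum//; last first.
  by move=> n x _; rewrite EFinM nnfun_muleindic_ge0.
under [RHS]eq_integral.
  move=> x xD; rewrite fimfunE -fsumEFin// muleC ge0_mule_fsumr; last first.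
    by move=> r; rewrite EFinM nnfun_muleindic_ge0.
  over.
rewrite [RHS]ge0_integral_fsum//; last 2 first.
  - by move=> r; exact: (emeasurable_funM mpdf (mt r)).
  - by move=> n x _; rewrite mule_ge0// EFinM nnfun_muleindic_ge0.
apply: eq_fsbigr => r /[!inE] -[x _ fxr].
have r0 : 0 <= r%:E by rewrite -fxr lee_fin.
under [LHS]eq_integral do rewrite EFinM.
rewrite ge0_integralZl//; last exact: mi.
have -> : \int[normal_prob 0 s]_t (\1_(f @^-1` [set r]) t)%:E =
    normal_prob 0 s (f @^-1` [set r]).
  have mA : measurable (f @^-1` [set r]) by [].
  rewrite integral_indic; [congr (normal_prob 0 s _); exact: setIT|by []|exact: mA].
under [RHS]eq_integral do rewrite EFinM muleCA.
rewrite ge0_integralZl//; last 2 first.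
  - by apply: emeasurable_funM; [exact: mpdf|exact: mi].
  - by move=> t _; rewrite mule_ge0.
congr (_ * _); rewrite /normal_prob [LHS]integral_mkcond/=.
apply: eq_integral => t _; rewrite patchE indicE.
by case: ifPn => _; rewrite ?mule1 ?mule0.
Qed.

Lemma integral_normal_prob (s : R) (f : R -> \bar R) :
  measurable_fun setT f -> (forall x, 0 <= f x) ->
  \int[normal_prob 0 s]_x f x = \int[mu]_x (f x * (normal_pdf 0 s x)%:E).
Proof.
move=> mf f0.
have mpdf : measurable_fun [set: R] (fun x : R => (normal_pdf 0 s x)%:E).
  by apply/measurable_EFinP; exact: measurable_normal_pdf.
have pdf0 x : 0 <= (normal_pdf 0 s x)%:E by rewrite lee_fin normal_pdf_ge0.
pose f_ := nnsfun_approx measurableT mf.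
have mf_ n : measurable_fun [set: R] (fun x : R => (f_ n x)%:E).
  by apply/measurable_EFinP; exact: measurable_funP.
have ndf m n x : (m <= n)%N -> (f_ m x <= f_ n x)%R.
  by move=> mn; exact/lefP/nd_nnsfun_approx.
transitivity (lim (\int[normal_prob 0 s]_x (f_ n x)%:E @[n --> \oo])).
  rewrite -monotone_convergence//=.
  - apply: eq_integral => ? /[!inE] xD; apply/esym/cvg_lim => //=.
    exact: cvg_nnsfun_approx.
  - by move=> n ? _; rewrite lee_fin.
  - by move=> ? _ ? ? mn; rewrite lee_fin ndf.
rewrite [RHS](_ : _ = lim
    (\int[mu]_x ((f_ n x)%:E * (normal_pdf 0 s x)%:E) @[n --> \oo])); last first.
  rewrite -monotone_convergence//=.
  - apply: eq_integral => x _; apply/esym/cvg_lim => //.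
    apply: cvgeZr => //; exact: cvg_nnsfun_approx.
  - by move=> n; apply: emeasurable_funM; [exact: mf_|exact: mpdf].
  - by move=> n ? _; rewrite mule_ge0// lee_fin.
  - by move=> x _ m n mn; apply: lee_wpmul2r; [exact: pdf0|rewrite lee_fin ndf].
exact: (congr1 (fun u : (\bar R)^nat => limn u)
  (funext (fun n => integral_normal_prob_nnsfun s (f_ n)))).
Qed.

(** Completing the square: the integrand times the density is a constant times the normal density
    with mean [- b / m] and standard deviation [s / Num.sqrt m]. *)
Lemma normal_tilt (s m b : R) : (0 < s)%R -> (0 < m)%R ->
  \int[normal_prob 0 s]_x
    (expR ((x ^+ 2 * (1 - m) - x * b *+ 2) / (s ^+ 2 *+ 2)))%:E =
  (Num.sqrt m^-1 * expR (b ^+ 2 / m / (s ^+ 2 *+ 2)))%:E.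
Proof.
move=> s0 m0; have s2 : (s ^+ 2 *+ 2 != 0)%R by rewrite mulrn_eq0/= expf_neq0 ?gt_eqF.
pose g (x : R) := ((x ^+ 2 * (1 - m) - x * (b *+ 2)) / (s ^+ 2 *+ 2))%R.
have mg : measurable_fun setT (fun x => (expR (g x))%:E).
  apply/measurable_EFinP/measurableT_comp => //.
  by apply: measurable_funM => //; apply: measurable_funB => //; exact: measurable_funM.
under eq_integral do rewrite -mulrnAr.
rewrite (integral_normal_prob _ _ mg); last by move=> x; rewrite lee_fin expR_ge0.
set t := (s / Num.sqrt m)%R.
have sm0 : (0 < Num.sqrt m)%R by rewrite sqrtr_gt0.
have t0 : (0 < t)%R by rewrite divr_gt0.
have tE : (t ^+ 2 = s ^+ 2 / m)%R by rewrite expr_div_n sqr_sqrtr// ltW.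
have peakE : (normal_peak s = Num.sqrt m^-1 * normal_peak t)%R.
  rewrite /normal_peak tE; move: pi => q.
  have -> : (s ^+ 2 / m * q *+ 2 = m^-1 * (s ^+ 2 * q *+ 2))%R.
    by rewrite mulrAC mulrC mulrnAr.
  rewrite sqrtrM ?invr_ge0 ?ltW// invfM mulVKf// gt_eqF//.
  by rewrite sqrtr_gt0 invr_gt0.
have pw x : (expR (g x) * normal_pdf 0 s x =
    Num.sqrt m^-1 * expR (b ^+ 2 / m / (s ^+ 2 *+ 2)) * normal_pdf (- b / m) t x)%R.
  rewrite !normal_pdfE ?gt_eqF// /normal_fun peakE subr0.
  have : (expR (g x) * expR (- x ^+ 2 / (s ^+ 2 *+ 2)) =
      expR (b ^+ 2 / m / (s ^+ 2 *+ 2)) * expR (- (x - - b / m) ^+ 2 / (t ^+ 2 *+ 2)))%R.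
    rewrite -!expRD tE /g; congr expR.
    have m1 : m != 0%R by rewrite gt_eqF.
    have s1 : s != 0%R by rewrite gt_eqF.
    by field; rewrite m1 s1.
  move: (expR _) (expR _) (expR _) (expR _) => e1 e2 e3 e4 e12.
  by rewrite mulrCA e12; ring.
transitivity (\int[mu]_x ((Num.sqrt m^-1 * expR (b ^+ 2 / m / (s ^+ 2 *+ 2)))%:E *
    (normal_pdf (- b / m) t x)%:E)).
  by apply: eq_integral => x _; rewrite -!EFinM pw.
have mpdf : measurable_fun [set: R] (fun x : R => (normal_pdf (- b / m) t x)%:E).
  by apply/measurable_EFinP; exact: measurable_normal_pdf.
rewrite ge0_integralZl; first by rewrite integral_normal_pdf mule1.
- by [].
- exact: mpdf.
- by move=> x _; rewrite lee_fin normal_pdf_ge0.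
- by rewrite lee_fin mulr_ge0// ?expR_ge0 ?sqrtr_ge0.
Qed.

End NormalIntegrals.

(** * Integrating out a variable independent of a sigma-algebra *)

Section Freezing.
Context {d} {T : measurableType d} {R : realType} (P : probability T R).
Variables (D : set (set T)) (e : T -> R) (mu : probability (measurableTypeR R) R).
Hypothesis Dm : D `<=` measurable.
Hypothesis DI : setI_closed D.
Hypothesis DT : D setT.
Hypothesis me : measurable_fun setT e.
Hypothesis eD : forall B S, measurable B -> D S ->
  (P (e @^-1` B `&` S) = mu B * P S)%E.

Local Notation TD := (g_sigma_algebraType D).

Lemma sub_sigma_measurable S : <<s D >> S -> measurable S.
Proof. exact: (smallest_sub (@sigma_algebra_measurable _ T) Dm). Qed.

Lemma measurable_fun_sub d' (U : measurableType d') (f : TD -> U) :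
  measurable_fun [set: TD] f -> measurable_fun [set: T] (f : T -> U).
Proof. by move=> mf _ Y mY; apply: sub_sigma_measurable; exact: mf. Qed.

(** The identity, read as a map into the coarser sigma-algebra generated by [D]. *)
Let idD : T -> TD := id.
Let midD : measurable_fun [set: T] idD.
Proof. by move=> _ Y mY; rewrite setTI; exact: sub_sigma_measurable. Qed.
HB.instance Definition _ := isMeasurableFun.Build _ _ _ _ idD midD.

Let joint : T -> measurableTypeR R * TD := fun w => (e w, w).
Let mjoint : measurable_fun [set: T] joint.
Proof. by apply: measurable_fun_pair. Qed.
HB.instance Definition _ := isMeasurableFun.Build _ _ _ _ joint mjoint.

(** For fixed [B] both sides are finite measures in [S] that agree on the pi-system [D], hence on
    the sigma-algebra it generates. *)
Let eDs B S : measurable B -> <<s D >> S ->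
  (P (e @^-1` B `&` S) = mu B * P S)%E.
Proof.
move=> mB; have meB : measurable (e @^-1` B) by rewrite -[X in measurable X]setTI; exact: me.
have muB : (mu B \is a fin_num)%E by exact: fin_num_measure.
pose r : {nonneg R} := NngNum (fine_ge0 (measure_ge0 mu B)).
have rE : r%:num%:E = mu B by rewrite /= fineK.
have main := @g_sigma_algebra_measure_unique _ R T D Dm (fun=> setT) (fun=> DT) _
  (mrestr P meB) (mscale r P) DI.
move=> DS; rewrite setIC -rE; apply: main => //.
- by apply/seteqP; split => // x _; exists 0%N.
- move=> A DA; change (P (A `&` e @^-1` B) = r%:num%:E * P A)%E.
  by rewrite setIC eD// rE.
- move=> k; apply: le_lt_trans (ltry 1); apply: probability_le1.
  by apply: measurableI.
Qed.

(* [e] is independent of [<<s D>>], so it may be integrated out separately. *)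
Lemma freezing (F : measurableTypeR R * TD -> \bar R) :
  measurable_fun setT F -> (forall z, 0 <= F z)%E ->
  (\int[P]_w F (e w, w) = \int[P]_w \int[mu]_x F (x, w))%E.
Proof.
move=> mF F0.
transitivity (\int[distribution P joint]_z F z)%E.
  by rewrite ge0_integral_distribution.
transitivity (\int[distribution P idD]_y fubini_G mu F y)%E.
  (* The joint law agrees with the product of [mu] and the law of [idD] on rectangles, hence
     everywhere, and Tonelli applies. *)
  rewrite -(fubini_tonelli2 (m1 := mu) (m2 := distribution P idD) F)//.
  apply: eq_measure_integral => A mA _; apply/esym.
  exact: product_measure_unique.
rewrite ge0_integral_distribution//; first exact: measurable_fun_fubini_tonelli_G.
by move=> y; exact: integral_ge0.
Qed.

End Freezing.

(** * Measurability of matrix-valued functions *)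

Section MeasurableMatrices.
Context {d} {U : measurableType d} {R : realType}.

(** The inverse is [f] times the power -1 of [f ^+ 2]: squaring brings the base into the range where
    the real power inverts, and both sides are 0 where [f] vanishes. *)
Lemma measurable_fun_inv (f : U -> R) : measurable_fun setT f ->
  measurable_fun setT (fun w => (f w)^-1).
Proof.
move=> mf; rewrite (_ : (fun _ => _) = fun w => f w * (f w ^+ 2) `^ (- 1)).
  apply: measurable_funM => //.
  apply: (measurableT_comp (measurable_powR _)); exact: measurable_funX.
apply/funext => w; rewrite powR_inv1 ?sqr_ge0//.
have [->|f0] := eqVneq (f w) 0; first by rewrite invr0 mul0r.
by rewrite expr2 invfM mulrA divff// mul1r.
Qed.

(** Truncation at 0 reconciles the real power with [Num.sqrt], which is 0 on negative numbers. *)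
Lemma measurable_fun_sqrt (f : U -> R) : measurable_fun setT f ->
  measurable_fun setT (fun w => Num.sqrt (f w)).
Proof.
move=> mf; rewrite (_ : (fun _ => _) = fun w => (Num.max (f w) 0) `^ (2^-1)).
  apply: (measurableT_comp (measurable_powR _)); exact: measurable_maxr.
apply/funext => w; rewrite powR12_sqrt ?le_max ?lexx ?orbT//.
have [f0|/ltW f0] := leP 0 (f w); first by [].
by rewrite sqrtr0 ler0_sqrtr.
Qed.

Definition mx_measurable {m n : nat} (A : U -> 'M[R]_(m, n)) :=
  forall i j, measurable_fun setT (fun w => A w i j).

Lemma mx_measurable_cst m n (A : 'M[R]_(m, n)) : mx_measurable (fun=> A).
Proof. by move=> i j; exact: measurable_cst. Qed.

Lemma mx_measurableZ m n (f : U -> R) (A : U -> 'M[R]_(m, n)) :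
  measurable_fun setT f -> mx_measurable A -> mx_measurable (fun w => f w *: A w).
Proof.
move=> mf mA i j; under eq_fun do rewrite mxE.
exact: measurable_funM.
Qed.

Lemma mx_measurableB m n (A B : U -> 'M[R]_(m, n)) :
  mx_measurable A -> mx_measurable B -> mx_measurable (fun w => A w - B w).
Proof.
move=> mA mB i j; under eq_fun do rewrite 2!mxE.
exact: measurable_funB.
Qed.

Lemma mx_measurableM m n p (A : U -> 'M[R]_(m, n)) (B : U -> 'M[R]_(n, p)) :
  mx_measurable A -> mx_measurable B -> mx_measurable (fun w => A w *m B w).
Proof.
move=> mA mB i j; under eq_fun do rewrite mxE.
by apply: measurable_sum => k; exact: measurable_funM.
Qed.

Lemma mx_measurable_tr m n (A : U -> 'M[R]_(m, n)) :
  mx_measurable A -> mx_measurable (fun w => (A w)^T).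
Proof. by move=> mA i j; under eq_fun do rewrite mxE; exact: mA. Qed.

Lemma mx_measurable_sub m n m' n' (f : 'I_m' -> 'I_m) (g : 'I_n' -> 'I_n)
    (A : U -> 'M[R]_(m, n)) :
  mx_measurable A -> mx_measurable (fun w => mxsub f g (A w)).
Proof. by move=> mA i j; under eq_fun do rewrite mxE; exact: mA. Qed.

Lemma measurable_det n (A : U -> 'M[R]_n) :
  mx_measurable A -> measurable_fun setT (fun w => \det (A w)).
Proof.
move=> mA; apply: measurable_sum => s; apply: measurable_funM => //.
by apply: measurable_prod => i _; exact: mA.
Qed.

Lemma mx_measurable_adj n (A : U -> 'M[R]_n) :
  mx_measurable A -> mx_measurable (fun w => \adj (A w)).
Proof.
move=> mA i j; under eq_fun do rewrite mxE.
apply: measurable_funM => //; apply: measurable_det => k l.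
by under eq_fun do rewrite !mxE; exact: mA.
Qed.

Lemma measurable_qf n (M : U -> 'M[R]_n) (v : U -> 'cV[R]_n) :
  mx_measurable M -> mx_measurable v -> measurable_fun setT (fun w => qf (M w) (v w)).
Proof.
move=> mM mv; apply: (mx_measurableM _ _ _ (fun w => (v w)^T *m M w) v) => //.
by apply: (mx_measurableM _ _ _ (fun w => (v w)^T)) => //; exact: mx_measurable_tr.
Qed.

Lemma measurable_nsq n (v : U -> 'cV[R]_n) :
  mx_measurable v -> measurable_fun setT (fun w => nsq (v w)).
Proof.
by move=> mv; apply: (mx_measurableM _ _ _ (fun w => (v w)^T) v) => //; exact: mx_measurable_tr.
Qed.

Lemma mx_measurable_proj n q (X : U -> 'M[R]_(n, q)) :
  mx_measurable X -> mx_measurable (fun w => colproj (X w)).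
Proof.
move=> mX; have mXT := mx_measurable_tr _ _ _ mX.
have mG := mx_measurableM _ _ _ _ _ mXT mX.
apply: (mx_measurableZ _ _ (fun w => (\det ((X w)^T *m X w))^-1)).
  exact/measurable_fun_inv/measurable_det.
apply: (mx_measurableM _ _ _ (fun w => X w *m \adj ((X w)^T *m X w))) => //.
by apply: (mx_measurableM _ _ _ X) => //; exact: (mx_measurable_adj _ (fun w => (X w)^T *m X w)).
Qed.

Lemma mx_measurable_schur n (M : U -> 'M[R]_(1 + n)) :
  mx_measurable M -> mx_measurable (fun w => schur (M w)).
Proof.
move=> mM; apply: (mx_measurableB _ _ (fun w => drsubmx (M w))
    (fun w => (M w 0 0)^-1 *: (dlsubmx (M w) *m ursubmx (M w)))).
  by move=> i j; under eq_fun do rewrite !mxE; exact: mM.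
apply: (mx_measurableZ _ _ (fun w => (M w 0 0)^-1)); first exact: measurable_fun_inv.
apply: (mx_measurableM _ _ _ (fun w => dlsubmx (M w))) => i j;
  by under eq_fun do rewrite !mxE; exact: mM.
Qed.

End MeasurableMatrices.

(** * Exponential moments of random quadratic forms in Gaussian noise *)

Section GaussianForms.
Context {d} {T : measurableType d} {R : realType} (P : probability T R).
Variables (sigma : R).
Hypothesis sigma0 : 0 < sigma.

Definition col_of {n : nat} (e : 'I_n -> T -> R) (w : T) : 'cV[R]_n :=
  \col_i e i w.

(** Independence of the noise from [D] and among its coordinates in one identity, tested on
    rectangles only; the extension to sigma-algebras takes place in [freezing]. *)
Definition gaussian_indep {n : nat} (D : set (set T)) (e : 'I_n -> T -> R) :=
  forall (B : 'I_n -> set (measurableTypeR R)) S, (forall i, measurable (B i)) -> D S ->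
  P ([set w | forall i, B i (e i w)] `&` S) =
  (\prod_(i < n) normal_prob 0 sigma (B i) * P S)%E.

(** Keeping the product form makes this a pi-system when [D] is one. It lets one noise coordinate be
    integrated out while the design and the other coordinates are frozen. *)
Definition adjoin {n : nat} (D : set (set T)) (e : 'I_n -> T -> R) : set (set T) :=
  [set A | exists B : 'I_n -> set (measurableTypeR R), exists S,
    [/\ forall i, measurable (B i), D S & A = [set w | forall i, B i (e i w)] `&` S]].

Lemma adjoin_measurable n (D : set (set T)) (e : 'I_n -> T -> R) :
  D `<=` measurable -> (forall i, measurable_fun setT (e i)) ->
  adjoin D e `<=` measurable.
Proof.
move=> Dm me _ [B [S [mB DS ->]]]; apply: measurableI; last exact: Dm.
rewrite (_ : [set _ | _] = \bigcap_(i in [set: 'I_n]) (e i @^-1` B i)).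
  apply: fin_bigcap_measurable => [|i _]; first exact: finite_finset.
  rewrite -[X in measurable X]setTI.
  exact: (me i measurableT _ (mB i)).
by apply/seteqP; split => [w wB i _|w wB i]; [exact: wB|exact: (wB i)].
Qed.

Lemma adjoinI n (D : set (set T)) (e : 'I_n -> T -> R) :
  setI_closed D -> setI_closed (adjoin D e).
Proof.
move=> DI _ _ [B [S [mB DS ->]]] [B' [S' [mB' DS' ->]]].
exists (fun i => B i `&` B' i), (S `&` S'); split.
- by move=> i; exact: measurableI.
- exact: DI.
- rewrite setIACA; congr (_ `&` _); apply/seteqP; split => w /=.
    by move=> [h h'] i; split; [exact: h|exact: h'].
  by move=> h; split => i; have [] := h i.
Qed.

Lemma adjoin_sub n (D : set (set T)) (e : 'I_n -> T -> R) : D `<=` adjoin D e.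
Proof.
move=> S DS; exists (fun=> setT), S; split => //.
by rewrite (_ : [set _ | _] = setT) ?setTI//; apply/seteqP; split.
Qed.

Lemma sub_adjoin_coord n (D : set (set T)) (e : 'I_n -> T -> R) i B :
  D setT -> measurable B -> adjoin D e (e i @^-1` B).
Proof.
move=> DT mB; exists (fun j => if j == i then B else setT), setT; split => //.
  by move=> j; case: ifP.
rewrite setIT; apply/seteqP; split => w /= h; first by move=> j; case: eqP => // ->.
by have := h i; rewrite eqxx.
Qed.

(** The first coordinate is left unconstrained by taking [setT] as its set. *)
Lemma gaussian_indep_lift n (D : set (set T)) (e : 'I_n.+1 -> T -> R) :
  gaussian_indep D e -> gaussian_indep D (fun i => e (lift ord0 i)).
Proof.
move=> eD B S mB DS.
have := eD (fun i => if unlift ord0 i is Some j then B j else setT) S.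
rewrite big_ord_recl unlift_none probability_setT mul1e.
under eq_bigr do rewrite liftK.
move=> <-//; last by move=> i; case: unliftP.
congr (P (_ `&` _)); apply/seteqP; split => w /= h i.
  by case: unliftP => // j ->.
by have := h (lift ord0 i); rewrite liftK.
Qed.

Lemma gaussian_indep_head n (D : set (set T)) (e : 'I_n.+1 -> T -> R) B S :
  gaussian_indep D e -> measurable B -> adjoin D (fun i => e (lift ord0 i)) S ->
  P (e ord0 @^-1` B `&` S) = (normal_prob 0 sigma B * P S)%E.
Proof.
move=> eD mB [B' [S' [mB' DS' ->]]].
have := gaussian_indep_lift _ _ _ eD B' S' mB' DS' => ->.
rewrite muleA; have := eD (fun i => if unlift ord0 i is Some j then B' j else B) S'.
rewrite big_ord_recl unlift_none; under eq_bigr do rewrite liftK.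
move=> <-//; last by move=> i; case: unliftP.
rewrite setIA; congr (P (_ `&` _)); apply/seteqP; split => w /=.
  by move=> [w0 h] i; case: unliftP => [j ->|->].
move=> h; split; first by have := h ord0; rewrite unlift_none.
by move=> i; have := h (lift ord0 i); rewrite liftK.
Qed.

Lemma qf_schurE n (M : 'M[R]_(1 + n)) v : M^T = M ->
  qf (schur M) v = qf (drsubmx M) v - (ursubmx M *m v) 0 0 ^+ 2 / M 0 0.
Proof.
move=> MT; rewrite /schur qfBl qfZl sym_dlsubmx// qf_gram nsqE big_ord1.
by rewrite mulrC.
Qed.

Lemma col_of_recl n (e : 'I_n.+1 -> T -> R) w :
  col_of e w = col_mx (e ord0 w)%:M (col_of (fun i => e (lift ord0 i)) w) :> 'cV_(1 + n).
Proof.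
apply/matrixP => i j; rewrite !mxE; case: splitP => k ik; rewrite !mxE.
  rewrite !ord1 eqxx mulr1n; congr (e _ w); apply: val_inj => /=.
  by rewrite ik ord1.
by congr (e _ w); apply: val_inj; rewrite /= ik.
Qed.

(* Integrating out the first coordinate of [e] multiplies [f] by [M00^(-1/2)] and
   replaces [M] by its Schur complement; [f] is there for this induction. *)
Lemma gaussian_integral n (D : set (set T)) (e : 'I_n -> T -> R)
    (f : g_sigma_algebraType D -> R) (M : g_sigma_algebraType D -> 'M[R]_n) lam :
  D `<=` measurable -> setI_closed D -> D setT ->
  (forall i, measurable_fun setT (e i)) -> gaussian_indep D e ->
  measurable_fun setT f -> (forall w, 0 <= f w) ->
  mx_measurable M -> 0 < lam -> (forall w, (M w)^T = M w) ->
  (forall w, coercive lam (M w)) ->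
  (\int[P]_w (f w * expR ((nsq (col_of e w) - qf (M w) (col_of e w)) / (sigma ^+ 2 *+ 2)))%:E
   = \int[P]_w (f w * Num.sqrt (\det (M w))^-1)%:E)%E.
Proof.
move=> Dm DI DT; elim: n e f M => [|n IH] e f M me eD mf f0 mM lam0 MT cM.
  apply: eq_integral => w _; rewrite det_mx00 invr1 sqrtr1.
  by rewrite /nsq /qf !mxE !big_ord0 subrr mul0r expR0.
pose e' i := e (lift ord0 i).
have me' i : measurable_fun setT (e' i) by exact: me.
have m0 w : 0 < (M w) 0 0 := lt_le_trans lam0 (coercive_diag _ _ _ (MT w) (cM w)).
transitivity (\int[P]_w (f w * Num.sqrt (M w 0 0)^-1 *
    expR ((nsq (col_of e' w) - qf (schur (M w)) (col_of e' w)) / (sigma ^+ 2 *+ 2)))%:E)%E;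
    last first.
  (* The remaining coordinates come first: the induction hypothesis is applied to the Schur
     complement, with the pivot factor absorbed into [f]. *)
  rewrite (IH e' (fun w => f w * Num.sqrt (M w 0 0)^-1) (fun w => schur (M w)))//.
  - apply: eq_integral => w _; rewrite [in RHS](det_schur _ (M w)) ?gt_eqF//.
    by rewrite invfM sqrtrM ?invr_ge0 ?ltW// mulrA.
  - exact: gaussian_indep_lift.
  - by apply: measurable_funM => //; apply: measurable_fun_sqrt; exact: measurable_fun_inv.
  - by move=> w; rewrite mulr_ge0// sqrtr_ge0.
  - exact: mx_measurable_schur.
  - by move=> w; exact: schur_sym.
  - by move=> w; exact: coercive_schur.
(* For the first coordinate, the others join the design. The exponent splits into [h], free of
   [e ord0], and [g], which has the shape integrated by [normal_tilt]. *)
pose D' := adjoin D e'.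
pose U := (measurableTypeR R * g_sigma_algebraType D')%type.
pose b (w : T) := (ursubmx (M w : 'M[R]_(1 + n)) *m col_of e' w) 0 0.
pose g (z : U) := (z.1 ^+ 2 * (1 - M z.2 0 0) - z.1 * b z.2 *+ 2) / (sigma ^+ 2 *+ 2).
pose h (w : T) := (nsq (col_of e' w) - qf (drsubmx (M w : 'M[R]_(1 + n))) (col_of e' w)) / (sigma ^+ 2 *+ 2).
pose F (z : U) := (f z.2 * expR (h z.2) * expR (g z))%:E.
have D'm : D' `<=` measurable by exact: adjoin_measurable.
have sDD' : forall f : T -> R, measurable_fun [set: g_sigma_algebraType D] f ->
    measurable_fun [set: g_sigma_algebraType D'] f.
  move=> k mk _ Y mY; have := mk measurableT Y mY; rewrite !setTI.
  by apply: sub_smallest2r; [exact: smallest_sigma_algebra|exact: adjoin_sub].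
have mM' i j : measurable_fun [set: g_sigma_algebraType D'] (fun w => M w i j).
  by apply: sDD'; exact: mM.
have mf' : measurable_fun [set: g_sigma_algebraType D'] f by exact: sDD'.
have mc : mx_measurable (fun w : g_sigma_algebraType D' => col_of e' w).
  move=> i j; under eq_fun do rewrite mxE; move=> _ Y mY; rewrite setTI.
  by apply: sub_sigma_algebra; exact: sub_adjoin_coord.
have mb : measurable_fun [set: g_sigma_algebraType D'] b.
  have mu : mx_measurable
      (fun w : g_sigma_algebraType D' => ursubmx (M w : 'M[R]_(1 + n))).
    by move=> i j; under eq_fun do rewrite !mxE; exact: mM'.
  exact: (mx_measurableM _ _ _ _ _ mu mc ord0 ord0).
have mh : measurable_fun [set: g_sigma_algebraType D'] h.
  apply: measurable_funM => //; apply: measurable_funB; first exact: measurable_nsq.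
  apply: measurable_qf => // i j; under eq_fun do rewrite !mxE; exact: mM'.
have snd_meas (k : g_sigma_algebraType D' -> R) : measurable_fun setT k ->
    measurable_fun setT (fun z : U => k z.2).
  by move=> mk; exact: (measurableT_comp mk measurable_snd).
have mfst : measurable_fun setT (fun z : U => z.1 : R) by exact: measurable_fst.
have mg : measurable_fun setT g.
  apply: measurable_funM => //; apply: measurable_funB.
    apply: measurable_funM; first exact: (measurable_funX 2 mfst).
    by apply: measurable_funB => //; exact: (snd_meas (fun w => M w 0 0)).
  rewrite (_ : (fun _ => _) = fun z : U => (z.1 * b z.2) * 2).
    apply: measurable_funM => //; apply: measurable_funM; first exact: mfst.
    exact: (snd_meas b).
  by apply/funext => z; rewrite mulr_natr.
have mF : measurable_fun setT F.
  apply/measurable_EFinP; apply: measurable_funM; last exact: measurableT_comp.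
  apply: (snd_meas (fun w => f w * expR (h w))); apply: measurable_funM => //.
  exact: measurableT_comp.
have F0 z : (0 <= F z)%E by rewrite lee_fin !mulr_ge0 ?expR_ge0.
transitivity (\int[P]_w F (e ord0 w, w))%E.
  apply: eq_integral => w _; congr EFin; rewrite -mulrA -expRD; congr (_ * expR _).
  rewrite /h /g /b -mulrDl col_of_recl nsq_col qf_block//; congr (_ / _).
  by rewrite /=; ring.
have e0D B S : measurable B -> D' S ->
    (P (e ord0 @^-1` B `&` S) = normal_prob 0 sigma B * P S)%E.
  exact: gaussian_indep_head.
rewrite (freezing _ _ _ (normal_prob 0 sigma) D'm (adjoinI _ _ e' DI)
  (adjoin_sub _ _ _ _ DT) (me ord0) e0D F mF F0).
apply: eq_integral => w _.
have mgw : measurable_fun setT (fun x => (expR (g (x, w)))%:E).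
  apply/measurable_EFinP; apply: measurableT_comp => //.
  exact: (measurableT_comp mg (pair2_measurable _)).
transitivity (\int[normal_prob 0 sigma]_x
    ((f w * expR (h w))%:E * (expR (g (x, w)))%:E))%E; first by apply: eq_integral.
rewrite ge0_integralZl; first last.
- by rewrite lee_fin mulr_ge0 ?expR_ge0.
- by move=> x _; rewrite lee_fin expR_ge0.
- exact: mgw.
- by [].
have -> : (\int[normal_prob 0 sigma]_x (expR (g (x, w)))%:E =
    (Num.sqrt (M w 0 0)^-1 * expR (b w ^+ 2 / M w 0 0 / (sigma ^+ 2 *+ 2)))%:E)%E.
  by rewrite -(normal_tilt _ _ _ sigma0 (m0 w)); apply: eq_integral.
rewrite -EFinM; congr EFin.
(* The term [b ^+ 2 / M 0 0] left by the Gaussian integral is exactly the Schur correction to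
   [drsubmx M]. *)
have <- : expR (h w) * expR (b w ^+ 2 / M w 0 0 / (sigma ^+ 2 *+ 2)) =
    expR ((nsq (col_of e' w) - qf (schur (M w)) (col_of e' w)) / (sigma ^+ 2 *+ 2)).
  rewrite -expRD; congr expR; rewrite /h -mulrDl; congr (_ / _).
  by rewrite qf_schurE// /b; ring.
by move: (expR _) (expR _) (Num.sqrt _) => x y z; ring.
Qed.

End GaussianForms.

(** * Chernoff bounds for the noise and its projections *)

Section TailBounds.
Context {d} {T : measurableType d} {R : realType} (P : probability T R).
Variables (sigma : R).
Hypothesis sigma0 : 0 < sigma.

(** Markov's inequality for the exponential moment computed in [gaussian_integral], with the
    determinant replaced by its lower bound [det0]. *)
Lemma gaussian_chernoff n (D : set (set T)) (e : 'I_n -> T -> R)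
    (M : g_sigma_algebraType D -> 'M[R]_n) lam a det0 :
  D `<=` measurable -> setI_closed D -> D setT ->
  (forall i, measurable_fun setT (e i)) -> gaussian_indep P sigma D e ->
  mx_measurable M -> 0 < lam -> (forall w, (M w)^T = M w) ->
  (forall w, coercive lam (M w)) -> 0 < det0 -> (forall w, det0 <= \det (M w)) ->
  let A := [set w | a <= nsq (col_of e w) - qf (M w) (col_of e w)] in
  measurable A /\
  (P A <= (expR (- a / (sigma ^+ 2 *+ 2)) * Num.sqrt det0^-1)%:E)%E.
Proof.
move=> Dm DI DT me eD mM lam0 MT cM det00 detM A.
set c := sigma ^+ 2 *+ 2.
have c0 : 0 < c by rewrite pmulrn_lgt0// exprn_gt0.
pose q w := nsq (col_of e w) - qf (M w) (col_of e w).
have mc : mx_measurable (col_of e) by move=> i j; under eq_fun do rewrite mxE; exact: me.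
have mMT : mx_measurable (M : T -> 'M[R]_n).
  by move=> i j; apply: measurable_fun_sub Dm _ _ _ _; exact: mM.
have mq : measurable_fun setT q.
  by apply: measurable_funB; [exact: measurable_nsq|exact: measurable_qf].
have mA : measurable A.
  rewrite (_ : A = q @^-1` `[a, +oo[%classic); last first.
    by apply/seteqP; split => w /=; rewrite in_itv/= andbT.
  by rewrite -[X in measurable X]setTI; exact: mq.
split=> //.
have mE : measurable_fun setT (fun w => (expR (q w / c))%:E).
  apply/measurable_EFinP; apply: measurableT_comp => //.
  exact: measurable_funM.
have E0 w : (0 <= (expR (q w / c))%:E)%E by rewrite lee_fin expR_ge0.
have h := gaussian_integral P _ sigma0 _ D e (fun=> 1) M lam Dm DI DT me eD
  (measurable_cst _) (fun=> ler01) mM lam0 MT cM.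
have mS : measurable_fun [set: T] (fun w => (Num.sqrt (\det (M w))^-1)%:E).
  apply/measurable_EFinP; apply: measurable_fun_sqrt; apply: measurable_fun_inv.
  exact: measurable_det.
have intE : (\int[P]_w (expR (q w / c))%:E <= (Num.sqrt det0^-1)%:E)%E.
  apply: (@le_trans _ _ (\int[P]_w (Num.sqrt (\det (M w))^-1)%:E)%E).
    under eq_integral do rewrite -[expR _]mul1r.
    by rewrite h; under eq_integral do rewrite mul1r.
  apply: (@le_trans _ _ (\int[P]_w (cst (Num.sqrt det0^-1)%:E w))%E).
    apply: ge0_le_integral => //.
    by move=> w _; rewrite lee_fin ler_wsqrtr// lef_pV2 ?posrE ?(lt_le_trans det00).
  rewrite integral_cst// -[leRHS]mule1; apply: lee_wpmul2l.
    by rewrite lee_fin sqrtr_ge0.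
  exact: probability_le1.
have PA : (P A = \int[P]_w (\1_A w)%:E)%E by rewrite integral_indic// setIT.
(* The indicator of [A] is dominated by [expR ((q w - a) / c)]. *)
apply: (@le_trans _ _ (\int[P]_w ((expR (- a / c))%:E * (expR (q w / c))%:E))%E).
  rewrite [leLHS]PA; apply: ge0_le_integral => //.
  - by apply/measurable_EFinP; exact: measurable_indic.
  - by apply: emeasurable_funM.
  - move=> w _; rewrite -EFinM lee_fin -expRD -mulrDl indicE.
    have [|_] := boolP (w \in A); last by rewrite expR_ge0.
    rewrite inE /A /= -/(q w) => aq.
    rewrite -[leLHS]expR0 ler_expR; apply: divr_ge0; last exact: ltW.
    by rewrite addrC subr_ge0.
rewrite ge0_integralZl; first last.
- by rewrite lee_fin expR_ge0.
- by move=> w _; exact: E0.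
- exact: mE.
- by [].
by rewrite EFinM; apply: lee_wpmul2l => //; rewrite lee_fin expR_ge0.
Qed.

(** Rectangles in the entries of [X]: a pi-system generating the sigma-algebra of the design, and
    the form in which the joint law is given. *)
Definition design_sets {n p : nat} (X : T -> 'M[R]_(n, p)) : set (set T) :=
  [set S | exists C : 'I_n -> 'I_p -> set R,
     (forall i j, measurable (C i j)) /\ S = [set w | forall i j, C i j (X w i j)]].

Context {n p : nat} (X : T -> 'M[R]_(n, p)) (eps : T -> 'cV[R]_n).
Hypothesis mX : forall i j, measurable_fun setT (fun w => X w i j).
Hypothesis meps : forall i, measurable_fun setT (fun w => eps w i 0).
Hypothesis law : forall (B : 'I_n -> set R) (C : 'I_n -> 'I_p -> set R),
  (forall i, measurable (B i)) -> (forall i j, measurable (C i j)) ->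
  P [set w | (forall i, B i (eps w i 0)) /\ (forall i j, C i j (X w i j))]
  = (\prod_(i < n) normal_prob 0 sigma (B i) *
     P [set w | forall i j, C i j (X w i j)])%E.

Let D := design_sets X.
Let e i w := eps w i 0.

Lemma design_sets_measurable : D `<=` measurable.
Proof.
move=> _ [C [mC ->]].
rewrite (_ : [set _ | _] = \bigcap_(ij in [set: 'I_n * 'I_p])
    ((fun w => X w ij.1 ij.2) @^-1` C ij.1 ij.2)).
  apply: fin_bigcap_measurable => [|i _]; first exact: finite_finset.
  by rewrite -[X in measurable X]setTI; apply: mX.
by apply/seteqP; split => [w wC ij _|w wC i j]; [exact: wC|exact: (wC (i, j))].
Qed.

Lemma design_setsI : setI_closed D.
Proof.
move=> _ _ [C [mC ->]] [C' [mC' ->]].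
exists (fun i j => C i j `&` C' i j); split; first by move=> i j; exact: measurableI.
apply/seteqP; split => w /=; first by move=> [h h'] i j; split; [exact: h|exact: h'].
by move=> h; split => i j; have [] := h i j.
Qed.

Lemma design_setsT : D setT.
Proof. by exists (fun _ _ => setT); split => //; apply/seteqP; split. Qed.

Lemma mx_measurable_design : mx_measurable (X : g_sigma_algebraType D -> _).
Proof.
move=> i j _ Y mY; rewrite setTI; apply: sub_sigma_algebra.
exists (fun i' j' => if (i' == i) && (j' == j) then Y else setT); split.
  by move=> i' j'; case: ifP.
apply/seteqP; split => w /= h; first by move=> i' j'; case: andP => // -[/eqP -> /eqP ->].
by have := h i j; rewrite !eqxx.
Qed.

Lemma noise_indep : gaussian_indep P sigma D e.
Proof.
move=> B _ mB [C [mC ->]].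
by have := law B C mB mC.
Qed.

Lemma col_of_noise w : col_of e w = eps w.
Proof. by apply/matrixP => i j; rewrite mxE (ord1 j). Qed.

(** With [M = 1 - s P_g] the difference [nsq - qf M] is [s] times the projected noise, and [det M]
    is at least [(1 - s) ^+ #|g|]. The bound is thus free of the design. *)
Lemma proj_tail (g : {set 'I_p}) s a : 0 <= s < 1 ->
  let A := [set w | a <= s * qf (colproj (Xsub (X w) g)) (eps w)] in
  measurable A /\
  (P A <= (expR (- a / (sigma ^+ 2 *+ 2)) * Num.sqrt ((1 - s) ^+ #|g|)^-1)%:E)%E.
Proof.
move=> /andP[s0 s1] A.
pose M w := 1%:M - s *: colproj (Xsub (X w) g).
have -> : A = [set w | a <= nsq (col_of e w) - qf (M w) (col_of e w)].
  by apply/seteqP; split => w /=; rewrite col_of_noise qfBl qf1 qfZl opprB addrC subrK.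
apply: (gaussian_chernoff _ D e M (1 - s)).
- exact: design_sets_measurable.
- exact: design_setsI.
- exact: design_setsT.
- exact: meps.
- exact: noise_indep.
- apply: mx_measurableB; first exact: mx_measurable_cst.
  apply: mx_measurableZ => //; apply: mx_measurable_proj.
  by apply: mx_measurable_sub; exact: mx_measurable_design.
- by rewrite subr_gt0.
- by move=> w; rewrite /M linearB /= linearZ /= proj_sym trmx1.
- by move=> w; exact: coercive_1Bproj.
- by rewrite exprn_gt0// subr_gt0.
- by move=> w; apply: det_1Bproj; rewrite s0 ltW.
Qed.

(** Taking [M] larger than the identity makes [nsq - qf M] equal to [- (t *+ 2) * nsq], so the upper
    tail bound becomes a lower tail bound. *)
Lemma noise_tail t a : 0 < t ->
  let A := [set w | nsq (eps w) <= a] in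
  measurable A /\
  (P A <= (expR (t * a / sigma ^+ 2) * Num.sqrt ((1 + t *+ 2) ^+ n)^-1)%:E)%E.
Proof.
move=> t0 A; have t1 : 0 < 1 + t *+ 2 by rewrite addr_gt0// pmulrn_lgt0.
have -> : A = [set w | - (t *+ 2 * a) <= nsq (col_of e w) - qf (1 + t *+ 2)%:M (col_of e w)].
  apply/seteqP; split => w /=;
  rewrite col_of_noise qf_scalar [(1 + _) * _]mulrDl mul1r opprD addrA subrr add0r;
  by rewrite lerN2 ler_pM2l// pmulrn_lgt0.
have -> : t * a / sigma ^+ 2 = - - (t *+ 2 * a) / (sigma ^+ 2 *+ 2).
  by field; rewrite gt_eqF.
apply: (gaussian_chernoff _ D e (fun=> (1 + t *+ 2)%:M) (1 + t *+ 2)) => //.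
- exact: design_sets_measurable.
- exact: design_setsI.
- exact: design_setsT.
- exact: noise_indep.
- by move=> _; exact: tr_scalar_mx.
- by move=> _ v; rewrite qf_scalar.
- by rewrite exprn_gt0.
- by move=> _; rewrite det_scalar.
Qed.

End TailBounds.

(** * Deterministic bounds on posterior weights *)

Lemma sqrtr_exp {R : realType} (x : R) k : 0 <= x ->
  Num.sqrt (x ^+ k) = Num.sqrt x ^+ k.
Proof.
by move=> x0; elim: k => [|k IH]; rewrite ?sqrtr1// !exprS sqrtrM// IH.
Qed.

Lemma detW_null {R : realType} {n p : nat} (X : 'M[R]_(n, p)) (c : 'I_p -> R) :
  \det (Wmat X c finset.set0) = 1.
Proof.
move: (Wmat X c finset.set0); rewrite cards0 => A; exact: det_mx00.
Qed.

Lemma mulmx_null {R : realType} {m q k : nat} (A : 'M[R]_(m, q)) (B : 'M[R]_(q, k)) :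
  q = 0%N -> A *m B = 0.
Proof.
move=> q0; apply/matrixP => i j; rewrite !mxE big1// => l _.
by have := ltn_ord l; rewrite {2}q0.
Qed.

(** Reduces to [a <= (a - x) * expR t], which follows from [1 + t <= expR t] and
    [(1 - y) * a <= a - x]. *)
Lemma powR_neg_le {R : realType} (a x N y : R) :
  0 <= N -> 0 < a -> 0 <= x -> x <= y * a -> y < 1 ->
  (a - x) `^ (- N) <= a `^ (- N) * expR (N * (x / ((1 - y) * a))).
Proof.
move=> N0 a0 x0 xy y1; set t := x / ((1 - y) * a).
have y1' : 0 < 1 - y by rewrite subr_gt0.
have ya : 0 < (1 - y) * a by rewrite mulr_gt0.
have t0 : 0 <= t by rewrite divr_ge0// ltW.
have ax : 0 < a - x by apply: lt_le_trans ya _; lra.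
have key : a <= (a - x) * expR t.
  apply: (@le_trans _ _ ((a - x) * (1 + t))); last by rewrite ler_pM2l// expR_ge1Dx.
  have -> : (a - x) * (1 + t) = a - x + (a - x) * t by ring.
  have -> : (a - x) * t = x * ((a - x) / ((1 - y) * a)) by rewrite /t; ring.
  suff : 1 <= (a - x) / ((1 - y) * a) by move=> h; have := ler_wpM2l x0 h; lra.
  by rewrite ler_pdivlMr//; lra.
have aN : 0 < a `^ N by rewrite powR_gt0.
have axN : 0 < (a - x) `^ N by rewrite powR_gt0.
rewrite !powRN -[X in X <= _]mul1r ler_pdivrMr// -mulrA ler_pdivlMl// mulr1 mulrC.
have -> : expR (N * t) = (expR t) `^ N by rewrite mulrC expRM.
rewrite -powRM ?expR_ge0 ?(ltW ax)//.
by apply: ge0_ler_powR => //; rewrite nnegrE ?mulr_ge0 ?expR_ge0 ?ltW.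
Qed.

Section PosteriorRatio.
Context {R : realType} {n p : nat}.
Variables (X : 'M[R]_(n, p)) (c : 'I_p -> R) (g : {set 'I_p}) (lo l : R).
Hypothesis lo0 : 0 < lo.
Hypothesis c_lo : forall j, lo <= c j.
Hypothesis l0 : 0 < l.

Let G := (Xsub X g)^T *m Xsub X g.
Let S := Sigsub c g.
Let rS := Sigsub_sqrt c g.

Hypothesis gram_l : coercive l G.

Let c_gt0 j : 0 < c j.
Proof. exact: lt_le_trans (c_lo j). Qed.

Let S_coercive : coercive lo S.
Proof.
move=> v; rewrite qf_diag nsqE mulr_sumr; apply: ler_sum => i _.
by rewrite mxE ler_wpM2r// sqr_ge0.
Qed.

Let S_unit : S \in unitmx.
Proof. exact: coercive_unitmx lo0 S_coercive. Qed.

Let Sinv_sym : (invmx S)^T = invmx S.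
Proof. by rewrite trmx_inv tr_diag_mx. Qed.

Let Sinv_ge0 : coercive 0 (invmx S).
Proof.
move=> v; rewrite mul0r qf_invmx ?tr_diag_mx//.
by apply: le_trans (S_coercive _); rewrite mulr_ge0 ?nsq_ge0 ?ltW.
Qed.

Let U_sym : (Umat X c g)^T = Umat X c g.
Proof. by rewrite /Umat linearD /= Sinv_sym gram_sym. Qed.

Let U_ge v : l * nsq v <= qf (Umat X c g) v.
Proof.
rewrite /Umat qfDl; apply: le_trans (gram_l v) _.
by rewrite lerDr; have := Sinv_ge0 v; rewrite mul0r.
Qed.

Let rS_sym : rS^T = rS.
Proof. by rewrite /rS /Sigsub_sqrt tr_diag_mx. Qed.

Let nsq_rS v : nsq (rS *m v) = qf S v.
Proof.
rewrite nsqE qf_diag; apply: eq_bigr => i _.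
by rewrite mul_diag_mx !mxE exprMn sqr_sqrtr// ltW.
Qed.

(** The form of [W] at [v] is that of [U] at [rS *m v], hence at least [l * qf S v] and so
    [l * lo * nsq v]; [coercive_det] concludes. *)
Lemma det_Wmat_ge : (l * lo) ^+ #|g| <= \det (Wmat X c g).
Proof.
apply: coercive_det; first exact: mulr_gt0.
  by rewrite /Wmat -/rS !trmx_mul rS_sym U_sym mulmxA.
move=> v; rewrite /Wmat -/rS -{1}rS_sym qf_congr; apply: le_trans (U_ge _).
by rewrite nsq_rS -mulrA ler_wpM2l// ltW.
Qed.

(** Adding the prior precision to the Gram matrix decreases the inverse, so the shrunk fit explains
    no more of [y] than the projection does. *)
Lemma shrunk_residual_ge (y : 'cV[R]_n) :
  nsq y - qf (colproj (Xsub X g)) y <=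
  (y^T *m (1%:M - Xsub X g *m invmx (Umat X c g) *m (Xsub X g)^T) *m y) 0 0.
Proof.
rewrite -/(qf _ y) qfBl qf1 lerB//.
have Gu : G \in unitmx by exact: coercive_unitmx l0 gram_l.
have congrE (A : 'M[R]_#|g|) : qf (Xsub X g *m A *m (Xsub X g)^T) y = qf A ((Xsub X g)^T *m y).
  by rewrite -qf_congr trmxK.
rewrite congrE qf_projE//.
apply: qf_inv_le => //.
- exact: gram_sym.
- exact: coercive0_gram.
- exact: coercive_unitmx l0 U_ge.
Qed.

(** The three factors are bounded separately: the determinant by [det_Wmat_ge], the prior by A1, the
    residual by [powR_neg_le] at [a = 1 + nsq y]. *)
Lemma post_weight_le (nu C0 xi : R) (prior : {set 'I_p} -> R) (y : 'cV[R]_n) :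
  0 < nu -> (forall g', 0 <= prior g') -> prior g <= C0 * prior finset.set0 ->
  xi < 1 -> qf (colproj (Xsub X g)) y <= xi * (1 + nsq y) ->
  post_weight nu prior X y c g <=
    C0 * Num.sqrt (l * lo)^-1 ^+ #|g| *
    expR ((n%:R + nu) / 2 * (qf (colproj (Xsub X g)) y / ((1 - xi) * (1 + nsq y)))) *
    post_weight nu prior X y c finset.set0.
Proof.
move=> nu0 prior0 prior_le xi1 Qxi; rewrite /post_weight.
set Q := qf _ y in Qxi *; set N := (n%:R + nu) / 2.
have N0 : 0 <= N by rewrite divr_ge0// addr_ge0// ltW.
have llo : 0 < l * lo by rewrite mulr_gt0.
have a0 : 0 < 1 + nsq y by rewrite ltr_pwDl// nsq_ge0.
have Q0 : 0 <= Q by exact: qf_proj_ge0.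
have detW : \det (Wmat X c g) `^ (- 2^-1) <= Num.sqrt (l * lo)^-1 ^+ #|g|.
  have d0 : 0 < (l * lo) ^+ #|g| by rewrite exprn_gt0.
  rewrite powRN powR12_sqrt; last exact: le_trans (ltW d0) det_Wmat_ge.
  have -> : Num.sqrt (l * lo)^-1 ^+ #|g| = (Num.sqrt ((l * lo) ^+ #|g|))^-1.
    by rewrite sqrtr_exp ?sqrtrV ?invr_ge0 ?exprVn ?ltW.
  rewrite lef_pV2 ?posrE ?sqrtr_gt0 ?(lt_le_trans d0 det_Wmat_ge)//.
  by rewrite ler_wsqrtr// det_Wmat_ge.
have hN : (1 + (y^T *m (1%:M - Xsub X g *m invmx (Umat X c g) *m (Xsub X g)^T) *m y) 0 0)
    `^ (- N) <= (1 + nsq y) `^ (- N) * expR (N * (Q / ((1 - xi) * (1 + nsq y)))).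
  apply: le_trans (powR_neg_le _ _ _ _ N0 a0 Q0 Qxi xi1).
  have aQ : 0 < 1 + nsq y - Q.
    have : 0 < (1 - xi) * (1 + nsq y) by rewrite mulr_gt0// subr_gt0.
    by lra.
  have le : 1 + nsq y - Q <=
      1 + (y^T *m (1%:M - Xsub X g *m invmx (Umat X c g) *m (Xsub X g)^T) *m y) 0 0.
    by rewrite -addrA lerD2l shrunk_residual_ge.
  rewrite !powRN lef_pV2 ?posrE ?powR_gt0 ?(lt_le_trans aQ le)//.
  by apply: ge0_ler_powR => //; rewrite nnegrE ltW ?(lt_le_trans aQ le).
rewrite detW_null powR1 mul1r (mulmx_null (Xsub X finset.set0) (invmx _) (cards0 _)).
rewrite mul0mx subr0 mulmx1 -/(nsq y).
rewrite -/N; set E := expR _ in hN *.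
apply: (@le_trans _ _ (Num.sqrt (l * lo)^-1 ^+ #|g| * (C0 * prior finset.set0) *
   ((1 + nsq y) `^ (- N) * E))).
  apply: ler_pM => //; first by rewrite mulr_ge0 ?powR_ge0.
    exact: powR_ge0.
  by apply: ler_pM => //; exact: powR_ge0.
by rewrite le_eqVlt; apply/orP; left; apply/eqP; ring.
Qed.

End PosteriorRatio.

Lemma post_weight_null {R : realType} {n p : nat} (X : 'M[R]_(n, p)) c nu
    (prior : {set 'I_p} -> R) y : 0 < prior finset.set0 ->
  0 < post_weight nu prior X y c finset.set0.
Proof.
move=> prior0; rewrite /post_weight detW_null powR1 mul1r.
rewrite (mulmx_null (Xsub X finset.set0) (invmx _) (cards0 _)).
rewrite mul0mx subr0 mulmx1 -/(nsq y) mulr_gt0// powR_gt0//.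
by rewrite ltr_pwDl// nsq_ge0.
Qed.

Lemma post_weight_ge0 {R : realType} {n p : nat} (X : 'M[R]_(n, p)) c nu
    (prior : {set 'I_p} -> R) y g : 0 <= prior g ->
  0 <= post_weight nu prior X y c g.
Proof. by move=> prior0; rewrite /post_weight !mulr_ge0 ?powR_ge0. Qed.

(** The argument at a fixed outcome of the good event. Replacing [n + nu] by [n] costs a factor
    [1 + xi]; the bound on [nsq y] and the denominator of [post_weight_le] cost [1 - xi] each. The
    gap between [alpha] and [alpha0] pays for all three. *)
Lemma good_ratio {R : realType} {n p : nat} (X : 'M[R]_(n, p)) (c : 'I_p -> R)
    (g : {set 'I_p}) (lo sigma nu C0 C3 delta alpha alpha0 xi L : R)
    (prior : {set 'I_p} -> R) (y : 'cV[R]_n) :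
  0 < lo -> (forall j, lo <= c j) -> 0 <= C0 -> 0 < C3 -> 0 < sigma -> 0 < nu -> (0 < n)%N ->
  (forall g', 0 <= prior g') -> prior g <= C0 * prior finset.set0 ->
  0 < alpha -> 0 < xi < 1 -> alpha * (1 + xi) <= alpha0 * (1 - xi) ^+ 2 -> 0 <= L ->
  alpha * (p%:R * L) <= xi * (1 - xi) * n%:R -> nu <= xi * n%:R ->
  C3 * n%:R `^ (- delta) <= lambda_min (n%:R^-1 *: ((Xsub X g)^T *m Xsub X g)) ->
  (1 - xi) * n%:R * sigma ^+ 2 <= nsq y ->
  qf (colproj (Xsub X g)) y <= sigma ^+ 2 * alpha * #|g|%:R * L ->
  post_weight nu prior X y c g <=
    C0 * (Num.sqrt (C3 * (n%:R `^ (1 - delta) * lo))^-1 * expR (alpha0 / 2 * L)) ^+ #|g| *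
    post_weight nu prior X y c finset.set0.
Proof.
move=> lo0 clo C00 C30 s0 nu0 n0 prior0 prior_le al0 /andP[xi0 xi1] alxi L0 pL nun lmin yn Qle.
have nR : 0 < n%:R :> R by rewrite ltr0n.
set G := (Xsub X g)^T *m Xsub X g in lmin.
(* A8 concerns the Gram matrix divided by n; the last factor undoes this scaling. *)
pose l := C3 * n%:R `^ (- delta) * n%:R.
have l0 : 0 < l by rewrite !mulr_gt0// powR_gt0.
have Gl : coercive l G.
  move=> v; have GT : (n%:R^-1 *: G)^T = n%:R^-1 *: G by rewrite linearZ /= gram_sym.
  have G0 : coercive 0 (n%:R^-1 *: G).
    by move=> u; rewrite mul0r qfZl mulr_ge0 ?invr_ge0// qf_gram nsq_ge0.
  have := coercive_lambda_min _ _ GT G0 v; rewrite qfZl ler_pdivlMl// mulrA => h.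
  apply: le_trans h; rewrite ler_wpM2r ?nsq_ge0// /l mulrC ler_wpM2l// ltW//.
have llo : l * lo = C3 * (n%:R `^ (1 - delta) * lo).
  have nE : n%:R `^ (1 - delta) = n%:R * n%:R `^ (- delta) :> R.
    by rewrite powRD ?(gt_eqF nR) ?implybT// powRr1// ltW.
  by rewrite nE /l; ring.
have q_p : #|g|%:R <= p%:R :> R.
  by rewrite ler_nat; apply: leq_trans (max_card _) _; rewrite card_ord.
have S0 := nsq_ge0 _ y; have sg : 0 < sigma ^+ 2 by rewrite exprn_gt0.
set q : R := #|g|%:R in q_p Qle *; have q0 : 0 <= q by rewrite ler0n.
set sg2 := sigma ^+ 2 in sg yn Qle; set S := nsq y in S0 yn *.
set P := p%:R in pL q_p; set N := n%:R in nR pL nun yn *.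
have x1 : 0 < 1 - xi by rewrite subr_gt0.
(* Here [p ln p = o(n)] enters: projecting on any model captures at most a fraction [xi] of the
   noise. *)
have Qxi : qf (colproj (Xsub X g)) y <= xi * (1 + S).
  apply: (le_trans Qle); apply: (@le_trans _ _ (sg2 * (alpha * (P * L)))).
    have : q * L <= P * L by rewrite ler_wpM2r.
    by move=> /(ler_wpM2l (ltW (mulr_gt0 sg al0))); nra.
  apply: (le_trans (ler_wpM2l (ltW sg) pL)).
  by have := ler_wpM2l (ltW xi0) yn; nra.
have := post_weight_le X c g lo l lo0 clo l0 Gl nu C0 xi prior y nu0 prior0 prior_le xi1 Qxi.
move=> /le_trans; apply.
apply: ler_wpM2r.
  have p0 : 0 <= prior finset.set0 by [].
  by exact: post_weight_ge0.
rewrite -llo exprMn.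
rewrite [leRHS]mulrA; apply: ler_wpM2l.
  by rewrite mulr_ge0// exprn_ge0// sqrtr_ge0.
rewrite -expRM_natr ler_expR -/q mulrA.
rewrite ler_pdivrMr; last by rewrite mulr_gt0// ltr_pwDl.
have := qf_proj_ge0 _ _ (Xsub X g) y; set Q := qf _ y in Qle Qxi * => Q0.
have h1 : (N + nu) / 2 * Q <= (1 + xi) * N / 2 * (sg2 * alpha * q * L).
  by apply: ler_pM => //; nra.
apply: (le_trans h1).
have qL : 0 <= q * L by rewrite mulr_ge0.
have h2 : (1 - xi) * N * sg2 <= 1 + S by lra.
have h3 := ler_wpM2l (mulr_ge0 qL (ltW (mulr_gt0 sg nR))) alxi.
have a00 : 0 <= alpha0.
  have /pmulr_lge0 <- : 0 < (1 - xi) ^+ 2 by rewrite exprn_gt0.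
  by apply: le_trans alxi; rewrite mulr_ge0 ?addr_ge0 ?ltW.
have h4 := ler_wpM2l (mulr_ge0 (mulr_ge0 a00 qL) (ltW x1)) h2.
rewrite -/S; lra.
Qed.

(** * Union bound over the models *)

Lemma sum_nonempty_exp_card {R : realType} (p : nat) (t : R) :
  \sum_(g : {set 'I_p} | g != finset.set0) t ^+ #|g| = (1 + t) ^+ p - 1.
Proof.
have E : (1 + t) ^+ p = \sum_(g : {set 'I_p}) t ^+ #|g|.
  rewrite addrC -[in LHS](card_ord p) -prodr_const bigA_distr.
  by apply: eq_bigr => J _; rewrite -big_mkcond /= prodr_const.
by rewrite E [in RHS](bigD1 finset.set0)//= cards0 expr0 addrC addrK.
Qed.

Lemma sum_nonempty_exp_card_le {R : realType} (p : nat) (t : R) : 0 <= t ->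
  \sum_(g : {set 'I_p} | g != finset.set0) t ^+ #|g| <= expR (p%:R * t) - 1.
Proof.
move=> t0; rewrite sum_nonempty_exp_card lerB// expRM_natl.
by apply: lerXn2r; rewrite ?nnegrE ?expR_ge0 ?addr_ge0// expR_ge1Dx.
Qed.

(** From [(1 - x) * expR x <= 1], as [1 - x] is at least one half. *)
Lemma expR_sub1_le {R : realType} (x : R) : 0 <= x <= 2^-1 -> expR x - 1 <= x *+ 2.
Proof.
move=> /andP[x0 x1]; have := expR_ge1Dx (- x); rewrite expRN => h.
have e0 := expR_gt0 x.
have : (1 - x) * expR x <= 1 by rewrite -ler_pdivlMr// mul1r.
by rewrite -mulr_natr; nra.
Qed.

Lemma union_bound d (T : measurableType d) (R : realType) (P : probability T R)
    (I : eqType) (s : seq I) (C : I -> set T) (b : I -> R) :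
  (forall i, measurable (C i)) -> (forall i, (P (C i) <= (b i)%:E)%E) ->
  exists A, [/\ measurable A, forall i, i \in s -> C i `<=` A &
    (P A <= (\sum_(i <- s) b i)%:E)%E].
Proof.
move=> mC PC; elim: s => [|i s [A [mA CA PA]]].
  by exists set0; split => //; rewrite big_nil measure0.
exists (C i `|` A); split; first exact: measurableU.
  move=> j; rewrite inE => /predU1P[->|js]; first exact: subsetUl.
  by apply: subset_trans (CA j js) _; exact: subsetUr.
rewrite big_cons EFinD; apply: le_trans (measureU2 _ _ _) _ => //.
by apply: leeD; [exact: PC|exact: PA].
Qed.

(** [A] unites the null set carrying the failures of [eig], the event of small noise, and the large
    projections over all nonempty models. The last two give the two terms of the bound. *)
Lemma bad_event d (T : measurableType d) (R : realType) (P : probability T R)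
    (sigma : R) (n p : nat) (X : T -> 'M[R]_(n, p)) (eps : T -> 'cV[R]_n)
    (s alpha t xi L : R) (eig : T -> Prop) :
  0 < sigma ->
  (forall i j, measurable_fun setT (fun w => X w i j)) ->
  (forall i, measurable_fun setT (fun w => eps w i 0)) ->
  (forall (B : 'I_n -> set R) (C : 'I_n -> 'I_p -> set R),
    (forall i, measurable (B i)) -> (forall i j, measurable (C i j)) ->
    P [set w | (forall i, B i (eps w i 0)) /\ (forall i j, C i j (X w i j))]
    = (\prod_(i < n) normal_prob 0 sigma (B i) *
       P [set w | forall i j, C i j (X w i j)])%E) ->
  {ae P, forall w, eig w} -> 0 <= s < 1 -> 0 < t ->
  exists A, [/\ measurable A,
    (P A <= ((expR (t * (1 - xi)) * Num.sqrt (1 + t *+ 2)^-1) ^+ n +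
      (expR (p%:R * (Num.sqrt (1 - s)^-1 * expR (- (s * alpha / 2 * L)))) - 1))%:E)%E &
    forall w, ~ A w -> [/\ eig w, (1 - xi) * n%:R * sigma ^+ 2 <= nsq (eps w) &
      forall g : {set 'I_p}, g != finset.set0 ->
        qf (colproj (Xsub (X w) g)) (eps w) <= sigma ^+ 2 * alpha * #|g|%:R * L]].
Proof.
move=> sigma0 mX meps law [Z [mZ PZ eigZ]] s01 t0.
have [s0 s1] := andP s01; have t1 : 0 < 1 + t *+ 2 by rewrite addr_gt0// pmulrn_lgt0.
have sg : 0 < sigma ^+ 2 by rewrite exprn_gt0.
set tau := Num.sqrt (1 - s)^-1 * expR (- (s * alpha / 2 * L)).
have [mB PB] := noise_tail P sigma sigma0 X eps mX meps law t ((1 - xi) * n%:R * sigma ^+ 2) t0.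
set B := [set w | _] in mB PB.
pose a (g : {set 'I_p}) := s * (sigma ^+ 2 * alpha * #|g|%:R * L).
pose C (g : {set 'I_p}) := [set w | a g <= s * qf (colproj (Xsub (X w) g)) (eps w)].
have mC g : measurable (C g) by have [] := proj_tail P sigma sigma0 X eps mX meps law g s (a g) s01.
have PC g : (P (C g) <= (tau ^+ #|g|)%:E)%E.
  have [_] := proj_tail P sigma sigma0 X eps mX meps law g s (a g) s01.
  rewrite -/(C g) => /le_trans; apply; rewrite lee_fin le_eqVlt; apply/orP; left.
  apply/eqP; rewrite /tau exprMn mulrC -expRM_natr; congr (_ * expR _).
    by rewrite -exprVn sqrtr_exp// invr_ge0 subr_ge0 ltW.
  by rewrite /a; field; rewrite gt_eqF.
have [A [mA CA PA]] := union_bound _ _ _ P _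
  [seq g <- index_enum {set 'I_p} | g != finset.set0] C _ mC PC.
exists (Z `|` (B `|` A)); split; first by do 2 apply: measurableU => //.
- apply: le_trans (measureU2 _ _ _) _ => //; first exact: measurableU.
  rewrite [X in (X + _ <= _)%E]PZ add0e.
  apply: le_trans (measureU2 _ _ _) _ => //; rewrite EFinD; apply: leeD.
    apply: (le_trans PB); rewrite lee_fin exprMn -expRM_natr.
    rewrite le_eqVlt; apply/orP; left; apply/eqP; congr (expR _ * _).
      by field; rewrite gt_eqF.
    by rewrite -exprVn sqrtr_exp// invr_ge0 ltW.
  apply: (le_trans PA); rewrite lee_fin big_filter.
  by apply: sum_nonempty_exp_card_le; rewrite mulr_ge0 ?sqrtr_ge0 ?expR_ge0.
- move=> w; rewrite /setU /= => /not_orP[nZ /not_orP[nB nA]]; split.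
  + by apply: contrapT => neig; apply: nZ; apply: eigZ.
  + by move: nB; rewrite /B /= => /negP; rewrite -ltNge => /ltW.
  + move=> g g0.
    have nC : ~ C g w.
      move=> Cg; apply: nA; apply: (CA g) => //.
      by rewrite mem_filter g0 mem_index_enum.
    move: nC; rewrite /C /= => /negP; rewrite -ltNge /a => h.
    (* For [s = 0] the strict inequality [h] would read [0 < 0]. *)
    have s00 : 0 < s.
      by rewrite lt_neqAle s0 andbT; apply: contraTneq h => <-; rewrite !mul0r ltxx.
    by move: h; rewrite ltr_pM2l// => /ltW.
Qed.

(** * Asymptotic rates and choice of constants *)

(** The square of the left side is [p n] to the power [a], divided by [C * N n]. *)
Lemma rate_small {R : realType} (p : nat -> nat) (N : nat -> R) (C a : R) :
  0 < C -> (\forall n \near \oo, (0 < p n)%N) -> (\forall n \near \oo, 0 < N n) ->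
  ((p n)%:R `^ a / N n : R) @[n --> \oo] --> (0 : R) ->
  forall e : R, 0 < e -> \forall n \near \oo,
    Num.sqrt (C * N n)^-1 * expR (a / 2 * ln (p n)%:R) <= e.
Proof.
move=> C0 p0 N0 lim e e0.
have Ce : 0 < C * e ^+ 2 by rewrite mulr_gt0// exprn_gt0.
have h := cvgr0_norm_lt _ lim _ Ce.
near=> n.
have pn : 0 < (p n)%:R :> R by rewrite ltr0n; near: n.
have Nn : 0 < N n by near: n.
have hn : `|(p n)%:R `^ a / N n| < C * e ^+ 2 by near: n; exact: h.
rewrite -(ler_pXn2r (n := 2))// ?nnegrE ?(ltW e0) ?mulr_ge0 ?sqrtr_ge0 ?expR_ge0//.
rewrite exprMn sqr_sqrtr ?invr_ge0 ?mulr_ge0 ?(ltW C0) ?(ltW Nn)//.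
have -> : expR (a / 2 * ln (p n)%:R) ^+ 2 = (p n)%:R `^ a.
  by rewrite -expRM_natr /powR (gt_eqF pn); congr expR; field.
rewrite invfM -mulrA ler_pdivrMl//.
by rewrite mulrC; apply: le_trans (ltW hn); exact: ler_norm.
Unshelve. all: by end_near. Qed.

(** The factor [p] costs one unit of the exponent [b], leaving [expR (- ((b - 1) * ln p))], which
    still vanishes. *)
Lemma union_rate_small {R : realType} (p : nat -> nat) (k b : R) :
  0 <= k -> 1 < b -> (forall M : R, \forall n \near \oo, M <= (p n)%:R) ->
  forall e : R, 0 < e -> \forall n \near \oo,
    (p n)%:R * (k * expR (- (b * ln (p n)%:R))) <= e.
Proof.
move=> k0 b1 pinf e e0; have b0 : 0 < b - 1 by rewrite subr_gt0.
have h := pinf (expR (k / e / (b - 1))).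
near=> n.
have hn : expR (k / e / (b - 1)) <= (p n)%:R by near: n; exact: h.
have pn : 0 < (p n)%:R :> R by apply: lt_le_trans hn; exact: expR_gt0.
have L1 : k / e / (b - 1) <= ln (p n)%:R.
  by rewrite -[leLHS]expRK ler_ln// posrE expR_gt0.
set L := ln _ in L1 *.
have -> : (p n)%:R * (k * expR (- (b * L))) = k * expR (- ((b - 1) * L)).
  rewrite -{1}(lnK (x := (p n)%:R))// -/L mulrCA -expRD; congr (_ * expR _); ring.
rewrite expRN ler_pdivrMr ?expR_gt0//.
apply: (@le_trans _ _ (e * (1 + (b - 1) * L))).
  by move: L1; rewrite ler_pdivrMr// ler_pdivrMr//; nra.
by rewrite ler_pM2l// expR_ge1Dx.
Unshelve. all: by end_near. Qed.

(** The base of [noise_tail] at [t = xi / 2]. Its square is [expR x / (1 + xi)] with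
    [x = xi - xi ^+ 2]; now [(1 - x) * expR x <= 1] while [(1 - x) * (1 + xi) = 1 + xi ^+ 3]. *)
Lemma chernoff_rate_lt1 {R : realType} (xi : R) : 0 < xi < 1 ->
  0 <= expR (xi / 2 * (1 - xi)) * Num.sqrt (1 + (xi / 2) *+ 2)^-1 < 1.
Proof.
move=> /andP[xi0 xi1]; rewrite mulr_ge0 ?expR_ge0 ?sqrtr_ge0//=.
have -> : 1 + (xi / 2) *+ 2 = 1 + xi by field.
have x1 : 0 < 1 + xi by rewrite addr_gt0.
rewrite -(ltr_pXn2r (n := 2))// ?nnegrE ?ler01 ?mulr_ge0 ?expR_ge0 ?sqrtr_ge0//.
rewrite exprMn sqr_sqrtr ?invr_ge0 ?(ltW x1)// expr1n ltr_pdivrMr// mul1r.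
rewrite -expRM_natr; set x := _ * 2%:R.
have xE : x = xi - xi ^+ 2 by rewrite /x; field.
have := expR_ge1Dx (- x); rewrite expRN => h.
have h1 : (1 - x) * expR x <= 1 by rewrite -ler_pdivlMr ?expR_gt0// mul1r.
have h2 : 0 < 1 - x by rewrite xE; nra.
rewrite -(ltr_pM2l h2); apply: (le_lt_trans h1).
have : 0 < xi ^+ 3 by rewrite exprn_gt0.
by rewrite xE; lra.
Qed.

(* [a] is the constant in the bound [a sigma^2 |g| ln p] on the projected noise:
   the union bound needs [s a > 2] for some [s < 1], while [xi] is the relative
   loss on [|eps|^2] and on [(n + nu) / n] that the gap [a < a0] can absorb. *)
Lemma tuning_constants {R : realType} (a0 : R) : 2 < a0 ->
  exists a s xi : R, [/\ 0 < a, 0 <= s < 1, 1 < s * a / 2, 0 < xi < 1 &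
    a * (1 + xi) <= a0 * (1 - xi) ^+ 2].
Proof.
move=> h0; pose a := (2 + a0) / 2.
have [a2 aa0] : 2 < a /\ a < a0 by rewrite /a; lra.
move: a a2 aa0 => a a2 aa0; have a_gt0 : 0 < a by lra.
have D0 : 0 < a + 2 * a0 by lra.
(* This [s] gives [s * a / 2 = (a + 2) / 4 > 1], and [xi] solves [a * (1 + xi) = a0 * (1 - 2 * xi)],
   which suffices since [1 - 2 * xi <= (1 - xi) ^+ 2]. *)
exists a, ((a + 2) / (2 * a)), ((a0 - a) / (a + 2 * a0)).
have -> : (a + 2) / (2 * a) * a / 2 = (a + 2) / 4 by field; rewrite gt_eqF.
set xi := _ / (a + _).
have xiE : xi * (a + 2 * a0) = a0 - a by rewrite /xi divfK// gt_eqF.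
split=> //.
- by rewrite divr_ge0 ?ltr_pdivrMr; lra.
- by lra.
- by rewrite /xi divr_gt0 ?ltr_pdivrMr//; lra.
- by have := sqr_ge0 xi; move: xiE; nra.
Qed.

(** * Posterior concentration on the null model *)

Theorem theorem2p2
  (R : realType) (d : measure_display) (T : measurableType d)
  (P : probability T R)
  (p : nat -> nat)
  (X : forall n : nat, T -> 'M[R]_(n, p n))
  (eps : forall n : nat, T -> 'cV[R]_n)
  (sigma0 nu : R)
  (prior : forall n : nat, {set 'I_(p n)} -> R)
  (phi_lo phi_up : nat -> R)
  (C0 C3 delta delta0 : R)
  (* sampling model: y = eps ~ N(0, sigma0^2 I_n) (gamma^0 = empty), and the
     (possibly random) design X is independent of eps; i.e. the joint law of
     (eps, X) is N(0,sigma0^2)^{(x) n} (x) Law(X), checked on rectangles *)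
  (Hsigma0 : 0 < sigma0)
  (HXmeas : forall n (i : 'I_n) (j : 'I_(p n)),
      measurable_fun setT (fun w => X n w i j))
  (Hepsmeas : forall n (i : 'I_n), measurable_fun setT (fun w => eps n w i 0))
  (Hlaw : forall n (B : 'I_n -> set R) (C : 'I_n -> 'I_(p n) -> set R),
      (forall i, measurable (B i)) -> (forall i j, measurable (C i j)) ->
      P [set w | (forall i, B i (eps n w i 0)) /\ (forall i j, C i j (X n w i j))]
      = (\prod_(i < n) normal_prob 0 sigma0 (B i) *
         P [set w | forall i j, C i j (X n w i j)])%E)
  (* all X_gamma^T X_gamma invertible a.s. *)
  (Hinv : forall n, {ae P, forall w, forall g : {set 'I_(p n)},
      (Xsub (X n w) g)^T *m Xsub (X n w) g \in unitmx})
  (* Bayesian model: nu > 0 fixed, prior a probability on models *)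
  (Hnu : 0 < nu)
  (Hprior_ge0 : forall n g, 0 <= prior n g)
  (Hprior_sum : forall n, \sum_(g : {set 'I_(p n)}) prior n g = 1)
  (* A1 (with gamma^0 = empty) *)
  (HA1 : 0 < C0 /\ forall n (g : {set 'I_(p n)}), prior n g <= C0 * prior n finset.set0)
  (* A5 (s_n = 0) *)
  (HA5_inf : forall M : R, \forall n \near \oo, M <= (p n)%:R)
  (HA5_le : forall n, (p n <= n)%N)
  (HA5_o : ((p n)%:R * ln ((p n)%:R) / n%:R : R) @[n --> \oo] --> (0 : R))
  (* A6 *)
  (HA6 : 0 < delta0 /\ exists K : R, \forall n \near \oo,
      `|phi_up n| <= K * (n%:R `^ delta0))
  (* A7 (k_n = 0 here, so k_n = O(phi_lo) is automatic) *)
  (HA7 : forall n, 0 < phi_lo n)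
  (* A8 (with gamma^0 = empty: S_1 = nonempty models, P_{gamma^0} = 0) *)
  (HA8_const : 0 < C3 /\ 0 <= delta)
  (HA8_lim : forall M : R, \forall n \near \oo,
      M <= n%:R `^ (1 - delta) * phi_lo n)
  (HA8_eig : forall n, {ae P, forall w, forall g : {set 'I_(p n)}, g != finset.set0 ->
      C3 * n%:R `^ (- delta) <=
      lambda_min ((n%:R)^-1 *: ((Xsub (X n w) g)^T *m Xsub (X n w) g))}) :
  let inbox n (c : 'I_(p n) -> R) := forall j, phi_lo n <= c j <= phi_up n in
  let post n w c g := posterior nu (prior n) (X n w) (eps n w) c g in
  (* (i) *)
  ((exists alpha0 : R, 2 < alpha0 /\
      ((p n)%:R `^ alpha0 / (n%:R `^ (1 - delta) * phi_lo n) : R)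
        @[n --> \oo] --> (0 : R)) ->
    forall e : R, 0 < e ->
      outer_prob_to0 P (fun n => [set w | exists c, inbox n c /\
         exists g : {set 'I_(p n)}, g != finset.set0 /\
           e < post n w c g / post n w c finset.set0]))
  /\
  (* (ii) *)
  ((exists alpha0 : R, 2 < alpha0 /\
      ((p n)%:R `^ (alpha0 + 2) / (n%:R `^ (1 - delta) * phi_lo n) : R)
        @[n --> \oo] --> (0 : R)) ->
    (forall e : R, 0 < e ->
      outer_prob_to0 P (fun n => [set w | exists c, inbox n c /\
         e < \sum_(g : {set 'I_(p n)} | g != finset.set0) post n w c g]))
    /\
    (forall e : R, 0 < e ->
      outer_prob_to0 P (fun n => [set w | exists c, inbox n c /\
         post n w c finset.set0 < 1 - e]))).
Proof.
move=> inbox post.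
have [C00 prior_le] := HA1; have [C30 delta_ge0] := HA8_const.
pose N n := n%:R `^ (1 - delta) * phi_lo n.
pose rho alpha0 n := Num.sqrt (C3 * N n)^-1 * expR (alpha0 / 2 * ln (p n)%:R).
have p_gt0 : \forall n \near \oo, (0 < p n)%N.
  by apply: filterS (HA5_inf 1) => n; rewrite ler1n.
have n_gt0 : \forall n \near \oo, (0 < n)%N by exists 1%N.
have N_gt0 : \forall n \near \oo, 0 < N n.
  by apply: filterS n_gt0 => n n0; rewrite mulr_gt0// powR_gt0// ltr0n.
(* If the null model had prior mass 0, A1 would make the whole prior vanish. *)
have prior0 n : 0 < prior n finset.set0.
  rewrite lt_neqAle Hprior_ge0 andbT; apply/eqP => p0.
  have := Hprior_sum n; rewrite big1 => [/eqP|g _]; first by rewrite eq_sym oner_eq0.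
  apply/eqP; rewrite eq_le Hprior_ge0 andbT.
  by have := prior_le n g; rewrite -p0 mulr0.
(* The exceptional event is chosen before [c] and [g], which makes the bound uniform over the
   hyperparameters. *)
have main alpha0 (halpha : 2 < alpha0) (eta : R) : 0 < eta -> \forall n \near \oo,
    exists A : set T, [/\ measurable A, (P A < eta%:E)%E &
      forall w, ~ A w -> forall c, inbox n c -> forall g, g != finset.set0 ->
        post_weight nu (prior n) (X n w) (eps n w) c g <=
        C0 * rho alpha0 n ^+ #|g| *
        post_weight nu (prior n) (X n w) (eps n w) c finset.set0].
  move=> eta0.
  have [alpha [s [xi [al0 s01 b1 xi01 alxi]]]] := tuning_constants _ halpha.
  have [xi0 xi1] := andP xi01.
  have xx : 0 < xi * (1 - xi) / alpha by apply: divr_gt0 => //; apply: mulr_gt0 => //; rewrite subr_gt0.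
  have r01 := chernoff_rate_lt1 xi xi01.
  set r := _ * Num.sqrt _ in r01; have [r0 r1] := andP r01.
  (* The noise event gets [eta / 4], and the projections at most twice that by [expR_sub1_le], whose
     range requires the cap at one half. *)
  have e0 : 0 < Num.min (eta / 4) 2^-1 by rewrite lt_min divr_gt0//= invr_gt0.
  have F1 := cvgr0_norm_lt _ HA5_o _ xx.
  have F2 := union_rate_small p (Num.sqrt (1 - s)^-1) _ (sqrtr_ge0 _) b1 HA5_inf _ e0.
  have F3 : \forall n \near \oo, `|r ^+ n| < eta / 4.
    by apply: cvgr0_norm_lt; [apply: cvg_expr; rewrite ger0_norm|rewrite divr_gt0].
  have F4 : \forall n \near \oo, nu / xi <= n%:R by exact: nbhs_infty_ger.
  near=> n.
  have f1 : `|(p n)%:R * ln (p n)%:R / n%:R| < xi * (1 - xi) / alpha by near: n; exact: F1.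
  have f2 : (p n)%:R * (Num.sqrt (1 - s)^-1 * expR (- (s * alpha / 2 * ln (p n)%:R)))
    <= Num.min (eta / 4) 2^-1 by near: n; exact: F2.
  have f3 : `|r ^+ n| < eta / 4 by near: n; exact: F3.
  have f4 : nu / xi <= n%:R by near: n; exact: F4.
  have n0 : (0 < n)%N by near: n.
  have p0 : (0 < p n)%N by near: n.
  have nR : 0 < n%:R :> R by rewrite ltr0n.
  have L0 : 0 <= ln (p n)%:R :> R by rewrite ln_ge0// ler1n.
  have [A [mA PA goodA]] := bad_event _ T R P sigma0 n (p n) (X n) (eps n) s alpha
    (xi / 2) xi (ln (p n)%:R) _ Hsigma0 (HXmeas n) (Hepsmeas n) (Hlaw n) (HA8_eig n)
    s01 (divr_gt0 xi0 (ltr0Sn _ 1)).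
  exists A; split=> //.
    apply: (le_lt_trans PA); rewrite lte_fin -/r.
    move: f2; rewrite le_min => /andP[f2 f2'].
    set u := _ * (_ * _) in f2 f2' *.
    have u0 : 0 <= u by rewrite !mulr_ge0 ?ler0n ?sqrtr_ge0 ?expR_ge0.
    have h := expR_sub1_le _ (introT andP (conj u0 f2')).
    move: f3; rewrite ger0_norm ?exprn_ge0// => f3.
    by clearbody u; clear -eta0 f2 f3 h; lra.
  move=> w nA c cbox g g0; have [eigw yn Qle] := goodA w nA.
  apply: (good_ratio _ _ _ (phi_lo n) sigma0 nu C0 C3 delta alpha alpha0 xi) => //.
  - by move=> j; have /andP[] := cbox j.
  - exact: ltW.
  - move: f1; rewrite ger0_norm; last by rewrite divr_ge0 ?mulr_ge0 ?ler0n.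
    rewrite ltr_pdivrMr// => f1; rewrite mulrC -ler_pdivlMr//.
    by apply: le_trans (ltW f1) _; rewrite mulrAC.
  - by move: f4; rewrite ler_pdivrMr// mulrC.
  - exact: eigw.
  - exact: Qle.
have pw0 n w c : 0 < post_weight nu (prior n) (X n w) (eps n w) c finset.set0.
  exact: post_weight_null.
have Z_ge n w c : post_weight nu (prior n) (X n w) (eps n w) c finset.set0 <=
    \sum_g post_weight nu (prior n) (X n w) (eps n w) c g.
  by rewrite (bigD1 finset.set0)//= lerDl sumr_ge0// => g _; exact: post_weight_ge0.
have Z_gt0 n w c : 0 < \sum_g post_weight nu (prior n) (X n w) (eps n w) c g.
  exact: lt_le_trans (Z_ge n w c).
have rho_ge0 alpha0 n : 0 <= rho alpha0 n by rewrite mulr_ge0 ?sqrtr_ge0 ?expR_ge0.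
split.
  move=> [alpha0 [al2 lim]] e e0 eta eta0.
  (* The cap at 1 gives [rho ^+ #|g| <= rho] for every nonempty model. *)
  have e1 : 0 < Num.min (e / C0) 1 by rewrite lt_min divr_gt0/=.
  have F1 := rate_small p N C3 alpha0 C30 p_gt0 N_gt0 lim _ e1.
  near=> n.
  have f1 : rho alpha0 n <= Num.min (e / C0) 1 by near: n; exact: F1.
  have [A [mA PA goodA]] : exists A : set T, [/\ measurable A, (P A < eta%:E)%E &
      forall w, ~ A w -> forall c, inbox n c -> forall g, g != finset.set0 ->
        post_weight nu (prior n) (X n w) (eps n w) c g <=
        C0 * rho alpha0 n ^+ #|g| *
        post_weight nu (prior n) (X n w) (eps n w) c finset.set0].
    by near: n; exact: main.
  exists A; split=> // w [c [cbox [g [g0]]]]; apply: contraPP => nA; apply/negP.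
  rewrite -leNgt /post /posterior invf_div mulrA divfK ?gt_eqF//.
  rewrite ler_pdivrMr//; apply: le_trans (goodA w nA c cbox g g0) _.
  apply: ler_wpM2r; first exact/ltW/pw0.
  move: f1; rewrite le_min ler_pdivlMr// mulrC => /andP[f1 f1'].
  apply: le_trans f1; apply: ler_wpM2l; first exact: ltW.
  rewrite -[leRHS]expr1; apply: ler_wiXn2l => //.
  by rewrite card_gt0.
move=> [alpha0 [al2 lim]].
have sum_small e : 0 < e -> outer_prob_to0 P (fun n => [set w | exists c, inbox n c /\
    e < \sum_(g : {set 'I_(p n)} | g != finset.set0) post n w c g]).
  move=> e0 eta eta0.
  (* The extra factor 2 and the cap again serve [expR_sub1_le]. *)
  have e1 : 0 < Num.min (e / C0 / 2) 2^-1 by rewrite lt_min !divr_gt0//= invr_gt0.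
  have F1 := rate_small p N C3 (alpha0 + 2) C30 p_gt0 N_gt0 lim _ e1.
  near=> n.
  have p0 : (0 < p n)%N by near: n.
  have f1 : rho (alpha0 + 2) n <= Num.min (e / C0 / 2) 2^-1 by near: n; exact: F1.
  have [A [mA PA goodA]] : exists A : set T, [/\ measurable A, (P A < eta%:E)%E &
      forall w, ~ A w -> forall c, inbox n c -> forall g, g != finset.set0 ->
        post_weight nu (prior n) (X n w) (eps n w) c g <=
        C0 * rho alpha0 n ^+ #|g| *
        post_weight nu (prior n) (X n w) (eps n w) c finset.set0].
    by near: n; exact: main.
  exists A; split=> // w [c [cbox]]; apply: contraPP => nA; apply/negP; rewrite -leNgt.
  (* Summing over models costs a factor [p]; as exponents are halved in [rho], it raises [alpha0] by
     2. *)
  have rhoE : (p n)%:R * rho alpha0 n = rho (alpha0 + 2) n.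
    rewrite /rho -{1}(lnK (x := (p n)%:R)) ?posrE ?ltr0n// mulrCA -expRD.
    by congr (_ * expR _); field.
  apply: (@le_trans _ _ (C0 * (expR ((p n)%:R * rho alpha0 n) - 1))).
    apply: le_trans (ler_wpM2l (ltW C00) (sum_nonempty_exp_card_le _ _ (rho_ge0 alpha0 n))).
    rewrite mulr_sumr; apply: ler_sum => g g0.
    (* The normalizing sum dominates the null weight, so a posterior probability is bounded like its
       ratio to the null. *)
    rewrite /post /posterior ler_pdivrMr//; apply: le_trans (goodA w nA c cbox g g0) _.
    apply: ler_wpM2l; last exact: Z_ge.
    by apply: mulr_ge0; [exact: ltW|exact: exprn_ge0].
  rewrite rhoE; move: f1; rewrite le_min => /andP[f1 f1'].
  have := expR_sub1_le _ (introT andP (conj (rho_ge0 (alpha0 + 2) n) f1')).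
  move=> h; rewrite mulrC -ler_pdivlMr//; apply: (le_trans h).
  by rewrite mulr2n; move: f1; lra.
split=> // e e0 eta eta0.
apply: filterS (sum_small e e0 eta eta0) => n [A [mA EA PA]].
exists A; split=> // w [c [cbox h]]; apply: EA; exists c; split=> //.
have : \sum_g post n w c g = 1 by rewrite /post /posterior -mulr_suml divff// gt_eqF.
by rewrite (bigD1 finset.set0)//=; move: h; lra.
Unshelve. all: by end_near. Qed.
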